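(* Let $g(n)$ denote the number of ordered factorizations of a positive integer $n$ into integers larger than one, and $G(n)$ the number of ordered factorizations of $n$ into pairwise coprime integers larger than one. For every fixed $\beta > 0$, as $x\to\infty$, each of the sums \[\sum_{n \leq x} g(n)^{-\beta}, \qquad \sum_{n \leq x} G(n)^{-\beta}\] equals \[\frac{x}{\log x} \exp\Bigl((1 + o(1))(1 + \beta)(\log 2)^{\beta/(1 + \beta)} (\log_2 x)^{1/(1 + \beta)}\Bigr).\]
   Context: $\log_k$ denotes the $k$-th iterate of the natural logarithm. By convention $g(1)=G(1)=1$. *)

(* Defs.v *)
From HB Require Import structures.
From mathcomp Require Import all_boot all_order all_algebra finmap.
From mathcomp Require Import all_classical all_reals all_analysis.

Set Implicit Arguments.
Unset Strict Implicit.
Unset Printing Implicit Defensive.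

Import Order.TTheory GRing.Theory Num.Theory.
Import numFieldNormedType.Exports.

Local Open Scope nat_scope.

(* An ordered factorization of n is the sequence of its factors; the empty
   sequence is one (the only one) of n = 1. *)
Definition ordered_factorization (n : nat) (s : seq nat) : bool :=
  all (fun d => 1 < d) s && (\prod_(d <- s) d == n).

Definition ordered_factorizations (n : nat) : set (seq nat) :=
  [set s | ordered_factorization n s]%classic.

Definition coprime_ordered_factorizations (n : nat) : set (seq nat) :=
  [set s | ordered_factorization n s && pairwise coprime s]%classic.

(* [fset_set] sends infinite sets to the empty set, which is harmless here by
   the two finiteness lemmas below. *)
Definition g (n : nat) : nat :=
  #|` fset_set (ordered_factorizations n)|%fset.

Definition G (n : nat) : nat :=
  #|` fset_set (coprime_ordered_factorizations n)|%fset.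

Lemma factor_le_prod (s : seq nat) : all (fun d => 1 < d) s ->
  [/\ 0 < \prod_(d <- s) d, size s <= \prod_(d <- s) d
    & all (fun d => d <= \prod_(d <- s) d) s].
Proof.
elim: s => [|a s IHs] /=; first by rewrite big_nil.
case/andP=> a1 /IHs[p0 ps pa]; rewrite big_cons.
have le_p : \prod_(d <- s) d < a * \prod_(d <- s) d by rewrite ltn_Pmull.
split; first exact: leq_ltn_trans le_p.
  exact: leq_ltn_trans le_p.
rewrite leq_pmulr //=; apply: sub_all pa => d dp.
exact: leq_trans dp (ltnW le_p).
Qed.

Lemma finite_ordered_factorizations (n : nat) :
  finite_set (ordered_factorizations n).
Proof.
pose f (u : {k : 'I_n.+1 & k.-tuple 'I_n.+1}) : seq nat :=
  map val (tagged u).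
apply: (@sub_finite_set _ _ (f @` setT)%classic); last first.
  exact/finite_image/finite_finset.
move=> s /= /andP[s1 /eqP sn]; have [_ sz le_n] := factor_le_prod s1.
rewrite sn in sz le_n.
have sz' : size (map (@inord n) s) == Ordinal (sz : size s < n.+1).
  by rewrite size_map.
exists (Tagged (fun k : 'I_n.+1 => k.-tuple 'I_n.+1) (Tuple sz')) => //.
rewrite /f /= -map_comp map_id_in // => d ds /=.
by rewrite inordK // ltnS (allP le_n).
Qed.

Lemma finite_coprime_ordered_factorizations (n : nat) :
  finite_set (coprime_ordered_factorizations n).
Proof.
apply: sub_finite_set (finite_ordered_factorizations n).
by move=> s /= /andP[].
Qed.

Lemma factorizations_of_one (s : seq nat) :
  ordered_factorization 1 s = (s == [::]).
Proof.
rewrite /ordered_factorization; case: s => [|a s]; first by rewrite big_nil.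
apply/negbTE/negP => /andP[/= /andP[a1 _]].
rewrite big_cons muln_eq1 => /andP[/eqP a_eq1 _].
by rewrite a_eq1 in a1.
Qed.

Lemma g1 : g 1 = 1.
Proof.
rewrite /g; have -> : ordered_factorizations 1 = [set [::]]%classic.
  apply/seteqP; split=> s; rewrite /ordered_factorizations /=
    factorizations_of_one; [by move/eqP | by move=> ->].
by rewrite fset_set1 cardfs1.
Qed.

Lemma G1 : G 1 = 1.
Proof.
rewrite /G; have -> : coprime_ordered_factorizations 1 = [set [::]]%classic.
  apply/seteqP; split=> s; rewrite /coprime_ordered_factorizations /=
    factorizations_of_one; [by case/andP => /eqP | by move=> ->].
by rewrite fset_set1 cardfs1.
Qed.

(* Main.v *)
(* The number [G n] of ordered factorizations into coprime factors depends only
   on the number [k] of distinct prime factors of [n]: it is the number of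
   ordered set partitions of a [k]-set, which lies between half of and the whole
   of [k! / (ln 2) ^ k]. Moreover [G n <= g n], with equality for squarefree [n].

   Upper bound. Since [t ^ k / k! <= exp t], for every [0 < z <= 1] the summand
   [G n ^ (- beta)] is at most a constant times
   [exp (beta * ln 2 / z ^ (1 / beta)) * z ^ k]. Writing [ln n] as a sum of
   von Mangoldt values over the divisors of [n] and using Chebyshev's bound
   [psi y <= 4 * y], the sum of [z ^ omega n] over [n <= x] is at most a constant
   times [x / ln x] times the sum of [z ^ omega n / n], which an Euler product and
   Mertens' theorem bound by a constant times [exp (z * ln (ln x))]. Taking
   [z = (ln 2 / ln (ln x)) ^ (beta / (1 + beta))] is optimal.

   Lower bound. Let [k] be the integer part of
   [kappa = (ln 2) ^ (beta / (1 + beta)) * (ln (ln x)) ^ (1 / (1 + beta))], and keep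
   only the products [n = p_1 ... p_(k - 1) * p] of [k] distinct primes in which the
   first [k - 1] are at most [x ^ (1 / (4 * k))] and [p] is larger than their
   product. Chebyshev's lower bound counts the admissible [p], and the
   elementary symmetric function of the [1 / p_i] is at least
   [((1 - o(1)) * ln (ln x)) ^ (k - 1) / (k - 1)!], because [k = o(ln (ln x))]. *)
Require Import Defs.
From HB Require Import structures.
From mathcomp Require Import all_boot all_order all_algebra finmap.
From mathcomp Require Import all_classical all_reals all_analysis.
From mathcomp Require Import zify ring lra.

Import Order.TTheory GRing.Theory Num.Theory.
Import numFieldNormedType.Exports.

Local Open Scope ring_scope.

Lemma ler_sum_seq (R : numDomainType) (I : eqType) (r : seq I) (F K : I -> R) :
  {in r, forall i, F i <= K i} -> \sum_(i <- r) F i <= \sum_(i <- r) K i.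
Proof. by move=> FK; rewrite !big_seq; apply: ler_sum. Qed.

(** * Unitary divisors and the recursion for [G] *)

Definition proper_unitary_divisors (n : nat) : seq nat :=
  [seq e <- divisors n | coprime e (n %/ e) && (e < n)%N].

Lemma unitary_quotient {n e : nat} : (1 < n)%N ->
  e \in proper_unitary_divisors n ->
  [/\ (0 < e)%N, (1 < n %/ e)%N, (n %/ e * e)%N = n & coprime e (n %/ e)].
Proof.
move=> n1; have n0 := ltnW n1.
rewrite mem_filter -dvdn_divisors // => /andP[/andP[ce en] ed].
have e0 : (0 < e)%N by exact: dvdn_gt0 ed.
by split=> //; [rewrite ltn_divRL// mul1n | exact: divnK].
Qed.

Lemma coprime_prod (d : nat) (s : seq nat) :
  coprime d (\prod_(e <- s) e) = all (coprime d) s.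
Proof.
elim: s => [|a s IH]; first by rewrite big_nil coprimen1.
by rewrite big_cons coprimeMr IH.
Qed.

(** Deleting the first factor [d] of a coprime factorization of [n] leaves a coprime factorization
    of [e = n / d]. This [e] is a proper unitary divisor, since all remaining factors are coprime to
    [d] and [d > 1]. *)
Lemma G_rec (n : nat) : (1 < n)%N ->
  G n = (\sum_(e <- proper_unitary_divisors n) G e)%N.
Proof.
move=> n1; have n0 := ltnW n1.
pose F e : seq (seq nat) := fset_set (coprime_ordered_factorizations e).
pose L := [seq (n %/ e)%N :: s | e <- proper_unitary_divisors n, s <- F e].
have memF e s : (s \in F e) = ordered_factorization e s && pairwise coprime s.
  rewrite /F in_fset_set; last exact: finite_coprime_ordered_factorizations.
  by apply/idP/idP => [/set_mem|? ]; [|exact/mem_set].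
have uL : uniq L.
  apply: allpairs_uniq_dep => [|e _|]; first by rewrite filter_uniq // divisors_uniq.
    exact: fset_uniq.
  move=> _ _ /allpairsPdep[e [s [eU sF ->]]] /allpairsPdep[e' [s' [eU' sF' ->]]] /=.
  have [e0 _ eE _] := unitary_quotient n1 eU.
  have [e0' _ eE' _] := unitary_quotient n1 eU'.
  case=> qq ss; have ee : e = e'.
    by apply/eqP; rewrite -(@eqn_pmul2l (n %/ e)) ?divn_gt0 ?eE ?qq ?eE' //;
       rewrite dvdn_leq // -eE dvdn_mull.
  by subst e'; subst s'.
transitivity (size L); last first.
  rewrite size_allpairs_dep sumnE big_map; exact: eq_bigr.
rewrite -(undup_id uL) -card_fseq /G; congr (#|` _|%fset); apply/fsetP => s.
rewrite -[s \in fset_set _]/(s \in F n) memF !inE.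
apply/idP/allpairsPdep => [|[e [s' [eU]]]].
  case: s => [|d s]; rewrite /ordered_factorization /=.
    by rewrite big_nil => /andP[/eqP nE]; rewrite -nE ltnn in n1.
  rewrite big_cons => /andP[/andP[/andP[d1 s1] /eqP nE] /andP[ds ps]].
  have e0 : (0 < \prod_(e <- s) e)%N by case: (factor_le_prod s1).
  have dE : (n %/ \prod_(e <- s) e)%N = d by rewrite -nE mulnK.
  exists (\prod_(e <- s) e)%N, s; split; last by rewrite dE.
    rewrite mem_filter dE coprime_sym coprime_prod ds -dvdn_divisors // -nE.
    by rewrite dvdn_mull // ltn_Pmull.
  by rewrite memF ps /ordered_factorization s1 eqxx.
have [e0 q1 eE ce] := unitary_quotient n1 eU.
rewrite memF => /andP[/andP[s1 /eqP sE] ps] ->.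
rewrite /ordered_factorization /= q1 s1 big_cons sE eE eqxx ps /=.
by rewrite -coprime_prod sE coprime_sym ce.
Qed.

Lemma sum_subset_card (V : nmodType) (T : finType) (P : {set T}) (u : nat -> V) :
  \sum_(A in powerset P) u #|A| = \sum_(j < #|P|.+1) u j *+ 'C(#|P|, j).
Proof.
rewrite (partition_big (fun A : {set T} => inord #|A| : 'I_#|P|.+1) predT) //=.
apply: eq_bigr => j _; rewrite -cards_draws -sumr_const.
apply: eq_big => [A|A].
  rewrite !inE; apply: andb_id2l => AP; apply/eqP/eqP => [<-|Aj].
    by rewrite inordK // ltnS subset_leq_card.
  by apply: val_inj; rewrite /= inordK // ltnS subset_leq_card.
rewrite !inE => /andP[AP /eqP <-]; congr u.
by rewrite inordK // ltnS subset_leq_card.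
Qed.

(** A unitary divisor contains each prime of [n] to its full exponent or not at all, so unitary
    divisors correspond to sets of primes of [n]. These sets are modelled as subsets of ['I_n.+1],
    and [partn] is the inverse map. *)
Lemma sum_unitary_divisors (V : nmodType) (n : nat) (u : nat -> V) :
  (0 < n)%N ->
  \sum_(e <- divisors n | coprime e (n %/ e)) u (size (primes e)) =
  \sum_(j < (size (primes n)).+1) u j *+ 'C(size (primes n), j).
Proof.
move=> n0; pose P := [set i : 'I_n.+1 | val i \in primes n].
pose pred_of (A : {set 'I_n.+1}) : nat_pred := [pred p | inord p \in A].
have primes_lt p : p \in primes n -> (p < n.+1)%N.
  by rewrite mem_primes => /and3P[_ _ /dvdn_leq]; exact.
have card_primes (e : nat) : (e %| n)%N ->
    size (primes e) = #|[set i : 'I_n.+1 | val i \in primes e]|.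
  move=> en; have e0 := dvdn_gt0 n0 en.
  rewrite cardsE cardE -(size_map val); apply: perm_size; apply: uniq_perm.
  - exact: primes_uniq.
  - by rewrite map_inj_uniq ?enum_uniq //; exact: val_inj.
  move=> p; apply/idP/mapP => [pe|[i]]; last by rewrite mem_enum => + ->.
  have pn : (p < n.+1)%N.
    by apply: primes_lt; move: pe; rewrite !mem_primes n0 => /and3P[-> _ /dvdn_trans ->].
  by exists (Ordinal pn); rewrite ?mem_enum.
have primes_of A : A \in powerset P ->
    [set i : 'I_n.+1 | val i \in primes n`_(pred_of A)] = A.
  rewrite inE => /fintype.subsetP AP; apply/setP => i.
  rewrite inE primes_part mem_filter inE inord_val.
  by case iA : (i \in A) => //=; move: (AP _ iA); rewrite inE.
have -> : size (primes n) = #|P| by exact: card_primes.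
rewrite -sum_subset_card -big_filter.
rewrite (perm_big [seq partn n (pred_of A) | A <- enum (powerset P)]) /=.
  rewrite big_map big_enum /=; apply: eq_bigr => A AP; congr u.
  by rewrite card_primes ?dvdn_part // primes_of.
apply: uniq_perm => [||e].
- by rewrite filter_uniq // divisors_uniq.
- rewrite map_inj_in_uniq ?enum_uniq // => A B; rewrite !mem_enum => AP BP AB.
  by rewrite -(primes_of _ AP) -(primes_of _ BP) AB.
rewrite mem_filter -dvdn_divisors //; apply/andP/mapP => [[ce ed]|[A _ ->]].
  exists [set i : 'I_n.+1 | val i \in primes e].
    rewrite mem_enum inE; apply/fintype.subsetP => i; rewrite !inE.
    by rewrite !mem_primes n0 => /and3P[-> _ /dvdn_trans ->].
  have e0 := dvdn_gt0 n0 ed; have q0 : (0 < n %/ e)%N by rewrite divn_gt0 // dvdn_leq.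
  set pi := pred_of _.
  have -> : partn n pi = (partn (n %/ e) pi * partn e pi)%N.
    by rewrite -partnM // divnK.
  rewrite part_p'nat ?mul1n.
    rewrite part_pnat_id // /pnat e0; apply/allP => p pe; rewrite /pi !inE /= inordK //.
    by apply: primes_lt; move: pe; rewrite !mem_primes n0 => /and3P[-> _ /dvdn_trans ->].
  rewrite /pnat q0; apply/allP => p pq; rewrite /pi !inE /= inordK; last first.
    apply: primes_lt; move: pq; rewrite !mem_primes n0 => /and3P[-> _ /dvdn_trans -> //].
    by rewrite -{2}(divnK ed) dvdn_mulr.
  by move: ce; rewrite coprime_has_primes // => /hasPn /(_ _ pq).
split; last exact: dvdn_part.
have nE := partnC (pred_of A) n0.
have -> : (n %/ n`_(pred_of A) = n`_(pred_of A)^')%N.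
  by rewrite -{1}nE mulKn ?part_gt0.
exact: coprime_partC.
Qed.

(** * Bounds for ordered set partitions *)

Section ExpPartialSums.
Context {R : realType}.
Implicit Types t : R.

Lemma exp_partial_le t (k : nat) : 0 <= t ->
  \sum_(j < k) t ^+ j / j`!%:R <= expR t.
Proof.
move=> t0; rewrite -(big_mkord predT (fun j => t ^+ j / j`!%:R)).
apply: (nondecreasing_cvgn_le _ (is_cvg_series_exp_coeff t)).
by apply: nondecreasing_series => i _ _; exact: exp_coeff_ge0.
Qed.

(** The factor [t ^ k / k!] comes out of the tail because [k! * j! <= (k + j)!]. *)
Lemma exp_le_partial t (k : nat) : 0 <= t ->
  expR t <= \sum_(j < k) t ^+ j / j`!%:R + t ^+ k / k`!%:R * expR t.
Proof.
move=> t0; rewrite {1}/expR; apply: limr_le; first exact: is_cvg_series_exp_coeff.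
exists k => // n /= kn; rewrite -(subnKC kn) /series /= big_mkord big_split_ord /=.
rewrite lerD2l.
apply: le_trans (_ : t ^+ k / k`!%:R * \sum_(j < n - k) t ^+ j / j`!%:R <= _).
  rewrite mulr_sumr; apply: ler_sum => j _; rewrite /exp_coeff /= exprD mulf_div.
  apply: ler_wpM2l; first by rewrite mulr_ge0 ?exprn_ge0.
  rewrite lef_pV2 ?posrE -?natrM ?ltr0n ?muln_gt0 ?fact_gt0 // ler_nat.
  have jk : (j <= k + j)%N by rewrite leq_addl.
  by rewrite -(bin_fact jk) addnK [X in (_ <= _ * X)%N]mulnC leq_pmull // bin_gt0.
by rewrite ler_wpM2l ?exp_partial_le // divr_ge0 ?exprn_ge0.
Qed.

End ExpPartialSums.

Section FubiniBounds.
Context {R : realType}.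

(** Up to the constant [1 / (2 * ln 2)], this is the asymptotic value of the [k]-th Fubini number,
    the number of ordered set partitions of a [k]-set. *)
Definition fact_ratio (k : nat) : R := k`!%:R / ln 2 ^+ k.

Lemma ln2_gt0 : 0 < ln 2 :> R. Proof. by rewrite ln_gt0 // ltr1n. Qed.

Lemma fact_ratio_gt0 k : 0 < fact_ratio k.
Proof. by rewrite divr_gt0 ?exprn_gt0 ?ln2_gt0 // ltr0n fact_gt0. Qed.

(** Since ['C(k, j) * j! = k! / (k - j)!], reversing the sum leaves a partial sum of the exponential
    series at [ln 2]. *)
Lemma sum_bin_fact_ratio (k : nat) :
  \sum_(j < k.+1) fact_ratio j *+ 'C(k, j) =
  fact_ratio k * \sum_(j < k.+1) ln 2 ^+ j / j`!%:R.
Proof.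
rewrite (reindex_inj rev_ord_inj) /= mulr_sumr; apply: eq_bigr => j _.
have jk : (j <= k)%N by rewrite -ltnS.
rewrite subSS bin_sub // /fact_ratio -mulr_natr -(bin_fact jk) !natrM.
have -> : ln 2 ^+ k = ln 2 ^+ j * ln 2 ^+ (k - j) :> R by rewrite -exprD subnKC.
have lne m : ln 2 ^+ m != 0 :> R by rewrite expf_neq0 // gt_eqF ?ln2_gt0.
have : j`!%:R != 0 :> R by rewrite pnatr_eq0 -lt0n fact_gt0.
by have := lne j; have := lne (k - j)%N => *; field; apply/and3P.
Qed.

Lemma sum_proper_unitary_divisors (n : nat) (u : nat -> R) : (1 < n)%N ->
  \sum_(e <- proper_unitary_divisors n) u (size (primes e)) =
  \sum_(j < (size (primes n)).+1) u j *+ 'C(size (primes n), j)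
  - u (size (primes n)).
Proof.
move=> n1; have n0 := ltnW n1; rewrite -sum_unitary_divisors // -[in RHS]big_filter.
apply/esym/eqP; rewrite subr_eq; apply/eqP.
transitivity (\sum_(e <- n :: proper_unitary_divisors n) u (size (primes e))).
  apply: perm_big; apply: uniq_perm.
  - by rewrite filter_uniq // divisors_uniq.
  - by rewrite /= mem_filter ltnn andbF filter_uniq // divisors_uniq.
  move=> e; rewrite inE !mem_filter -dvdn_divisors //.
  have [->|en] /= := eqVneq e n; first by rewrite divnn n0 coprimen1 dvdnn.
  apply: andb_id2r => /(dvdn_leq n0); rewrite leq_eqVlt (negbTE en) /= => ->.
  by rewrite andbT.
by rewrite big_cons addrC.
Qed.

(* The bounds are stable under the recursion because [exp (ln 2) - 1 = 1]. *)
Lemma G_bounds (n : nat) : (0 < n)%N ->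
  fact_ratio (size (primes n)) / 2 <= (G n)%:R <= fact_ratio (size (primes n)).
Proof.
elim/ltn_ind: n => n IH; rewrite leq_eqVlt => /predU1P[<-|n1].
  by rewrite G1 /fact_ratio /= fact0 expr0 divr1 mul1r lexx andbT invf_le1 ?ler1n.
set k := size _.
have k0 : (0 < k)%N by rewrite lt0n size_eq0 primes_eq0 -leqNgt.
have l0 := @ln2_gt0; have l0' := ltW l0.
have e2 : expR (ln 2) = 2 :> R by rewrite lnK // posrE ltr0n.
have hk := fact_ratio_gt0 k.
have U e : e \in proper_unitary_divisors n -> (0 < e < n)%N.
  by move=> eU; have [-> _ _ _] := unitary_quotient n1 eU;
     move: eU; rewrite mem_filter => /andP[/andP[]].
have primes1 e : (0 < e)%N -> (size (primes e) == 0%N) = (e == 1%N).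
  by case: e => [//|[//|e]] _; rewrite size_eq0 primes_eq0.
rewrite G_rec // natr_sum; apply/andP; split; last first.
  apply: le_trans (_ : \sum_(e <- proper_unitary_divisors n)
    fact_ratio (size (primes e)) <= _).
    apply: ler_sum_seq => e eU.
    by have /andP[e0 en] := U _ eU; have /andP[] := IH e en e0.
  rewrite (sum_proper_unitary_divisors n fact_ratio) // sum_bin_fact_ratio -/k.
  have := @exp_partial_le R (ln 2) k.+1 l0'; rewrite e2; set s := \sum_(_ < _) _.
  nra.
(* The divisor [e = 1] has [G 1 = fact_ratio 0 = 1], which beats the inductive bound by [1 / 2]. As
   [fact_ratio k * (ln 2 ^ k / k!) = 1], this surplus pays for the tail of the exponential
   series. *)
apply: le_trans (_ : \sum_(e <- proper_unitary_divisors n)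
   (fact_ratio (size (primes e)) / 2 + (size (primes e) == 0%N)%:R / 2) <= _); last first.
  apply: ler_sum_seq => e eU.
  have /andP[e0 en] := U _ eU.
  rewrite primes1 //; have [->|_] := eqVneq e 1%N.
    by rewrite G1 /fact_ratio /= fact0 expr0; lra.
  by have /andP[h _] := IH e en e0; rewrite mul0r addr0.
rewrite (sum_proper_unitary_divisors n (fun j => fact_ratio j / 2 + (j == 0%N)%:R / 2)) //.
have -> : \sum_(j < k.+1) (fact_ratio j / 2 + (j == 0%N :> nat)%:R / 2) *+ 'C(k, j) =
    (\sum_(j < k.+1) fact_ratio j *+ 'C(k, j)) / 2 +
    (\sum_(j < k.+1) (j == 0%N :> nat)%:R *+ 'C(k, j)) / 2 :> R.
  rewrite !mulr_suml -big_split /=; apply: eq_bigr => j _.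
  by rewrite mulrnDl !mulrnAl.
rewrite sum_bin_fact_ratio -/k.
have -> : \sum_(j < k.+1) (j == 0%N :> nat)%:R *+ 'C(k, j) = 1 :> R.
  by rewrite big_ord_recl big1 /= ?bin0 ?addr0 // => j _; rewrite mul0rn.
rewrite (gtn_eqF k0) mul0r addr0 big_ord_recr /=.
have := @exp_le_partial R (ln 2) k l0'; rewrite e2; set s := \sum_(_ < _) _.
have : fact_ratio k * (ln 2 ^+ k / k`!%:R) = 1.
  rewrite /fact_ratio mulf_div [X in X / _]mulrC divff //.
  by rewrite mulf_neq0 ?expf_neq0 // gt_eqF // ltr0n fact_gt0.
set v := _ / k`!%:R; nra.
Qed.

End FubiniBounds.

(** * Comparison of [g] with [G] *)

Lemma G_le_g (n : nat) : (G n <= g n)%N.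
Proof.
apply: fsubset_leq_card; apply/fsubsetP => s.
rewrite !in_fset_set ?inE; try exact: finite_ordered_factorizations;
  try exact: finite_coprime_ordered_factorizations.
by move=> /andP[].
Qed.

(** A prime dividing two different factors would divide [n] with exponent at least 2, so all ordered
    factorizations are coprime. *)
Lemma g_squarefree (n : nat) : (0 < n)%N ->
  (forall p, prime p -> (logn p n <= 1)%N) -> g n = G n.
Proof.
move=> n0 sqf; rewrite /g /G; congr (#|` fset_set _|%fset).
apply/seteqP; split=> s; last by move=> /andP[].
rewrite /ordered_factorizations /coprime_ordered_factorizations /= => sn.
rewrite sn /=; move: sn n0 sqf => /andP[_ /eqP <-] {n}.
elim: s => //= d s IH; rewrite big_cons muln_gt0 => /andP[d0 p0] sqf.
rewrite -coprime_prod IH // ?andbT => [|p pp]; last first.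
  by apply: leq_trans (sqf p pp); rewrite lognM // leq_addl.
rewrite coprime_has_primes //; apply/hasPn => p pP; apply/negP => pd.
move: pP pd; rewrite /= -!logn_gt0 => pP pd.
have /sqf : prime p by move: pd; rewrite logn_gt0 mem_primes => /and3P[].
by rewrite lognM // leqNgt -addn1 leq_add.
Qed.

(** * The von Mangoldt function, Chebyshev's and Mertens' bounds *)

Section Mangoldt.
Context {R : realType}.

Lemma ln_prod_nat (I : Type) (r : seq I) (P : pred I) (F : I -> nat) :
  (forall i, P i -> (0 < F i)%N) ->
  ln (\prod_(i <- r | P i) F i)%:R = \sum_(i <- r | P i) ln (F i)%:R :> R.
Proof.
move=> F0; elim: r => [|i r IH]; first by rewrite !big_nil ln1.
rewrite !big_cons; case: ifPn => // Pi.
by rewrite natrM lnM ?IH // posrE ltr0n ?F0 // prodn_cond_gt0.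
Qed.

Lemma ln_nat_ge0 (n : nat) : 0 <= ln n%:R :> R.
Proof. by case: n => [|n]; [rewrite ln0 | rewrite ln_ge0 // ler1n]. Qed.

Lemma ln_nat_gt0 (n : nat) : (1 < n)%N -> 0 < ln n%:R :> R.
Proof. by move=> n1; rewrite ln_gt0 // ltr1n. Qed.

Lemma ler_ln_nat (m n : nat) : (0 < m)%N -> (m <= n)%N ->
  ln m%:R <= ln n%:R :> R.
Proof.
by move=> m0 mn; rewrite ler_ln ?posrE ?ltr0n ?ler_nat //; exact: leq_trans mn.
Qed.

Lemma ln_le_self (n : nat) : ln n%:R <= n%:R - 1 + (n == 0%N)%:R :> R.
Proof.
case: n => [|n]; first by rewrite ln0 // sub0r addrC subrr.
rewrite addr0 -natr1 addrK addrC; apply: le_ln1Dx.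
by apply: lt_le_trans (ler0n _ _); rewrite ltrN10.
Qed.

(** Written as a sum over all pairs [(p, k)] with [p ^ k = d], of which there is at most one, so
    that sums over [d] can be exchanged with sums over [p] and [k]. *)
Definition mangoldt (d : nat) : R :=
  \sum_(1 <= p < d.+1 | prime p) \sum_(1 <= k < d.+1 | (p ^ k == d)%N) ln p%:R.

Lemma mangoldt_widen (d N : nat) : (d <= N)%N ->
  mangoldt d =
  \sum_(1 <= p < N.+1 | prime p) \sum_(1 <= k < N.+1 | (p ^ k == d)%N) ln p%:R.
Proof.
move=> dN.
rewrite [RHS](bigID (fun p => p < d.+1)%N) /= [X in _ + X]big1 ?addr0; last first.
  move=> p /andP[pp]; rewrite -leqNgt => dp.
  rewrite big_nat_cond big1 // => k /andP[/andP[k1 _] /eqP pkd].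
  have := ltn_expl k (prime_gt1 pp).
  move: dp; rewrite -{1}pkd; case: k k1 pkd => // k _ _.
  by rewrite expnS ltnNge leq_pmulr ?expn_gt0 ?prime_gt0.
rewrite /mangoldt (big_nat_widen _ d.+1 N.+1) //; apply: eq_bigr => p /andP[pp _].
rewrite (big_nat_widen _ d.+1 N.+1) //; apply: eq_bigl => k.
by apply: andb_idr => /eqP <-; rewrite ltnS ltnW // ltn_expl // prime_gt1.
Qed.

(** Used with [phi] the indicator of the divisors of [n], which yields [ln n], and with [phi = 1],
    which yields [psi]. *)
Lemma sum_mangoldt (phi : nat -> R) (N : nat) :
  \sum_(1 <= d < N.+1) phi d * mangoldt d =
  \sum_(1 <= p < N.+1 | prime p)
    \sum_(1 <= k < N.+1 | (p ^ k <= N)%N) phi (p ^ k)%N * ln p%:R.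
Proof.
transitivity (\sum_(1 <= d < N.+1) \sum_(1 <= p < N.+1 | prime p)
    \sum_(1 <= k < N.+1 | (p ^ k == d)%N) phi d * ln p%:R).
  apply: eq_big_nat => d /andP[_ dN]; rewrite (mangoldt_widen _ N) // mulr_sumr.
  by apply: eq_bigr => p _; rewrite mulr_sumr.
rewrite exchange_big /=; apply: eq_bigr => p pp.
rewrite (exchange_big_dep_nat predT) //= [RHS]big_mkcond /=; apply: eq_bigr => k _.
under eq_bigl do rewrite eq_sym.
rewrite big_nat1_eq ltnS expn_gt0 prime_gt0 //=.
Qed.

Lemma mangoldt_ge0 (d : nat) : 0 <= mangoldt d.
Proof. by apply: sumr_ge0 => p _; apply: sumr_ge0 => k _; exact: ln_nat_ge0. Qed.

Lemma ln_nat_factor (n : nat) : (0 < n)%N ->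
  ln n%:R = \sum_(1 <= p < n.+1 | prime p) (logn p n)%:R * ln p%:R :> R.
Proof.
move=> n0; rewrite -{1}(partnT n0) /partn big_ltn_cond //= [logn 0 n]lognE /= mul1n.
rewrite ln_prod_nat => [|p _]; last by have [->|//] := posnP p; rewrite ?expn_gt0 // lognE.
rewrite [RHS]big_mkcond /= big_nat_cond [RHS]big_nat_cond.
apply: eq_bigr => p /andP[/andP[p0 _] _]; case: ifPn => pp.
  by rewrite natrX lnXn ?ltr0n // mulr_natl.
by rewrite lognE (negbTE pp) /= ln1.
Qed.

(** Each prime [p] contributes [ln p] once for every [1 <= k <= logn p n]. *)
Lemma sum_mangoldt_dvd (n : nat) : (0 < n)%N ->
  \sum_(1 <= d < n.+1 | (d %| n)%N) mangoldt d = ln n%:R.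
Proof.
move=> n0; rewrite big_mkcond /=.
under eq_bigr do rewrite -mulrb -mulr_natl.
rewrite (sum_mangoldt (fun d => (d %| n)%:R)) ln_nat_factor //.
apply: eq_bigr => p pp; rewrite -mulr_suml; congr (_ * _).
under eq_bigr do rewrite mulrb.
rewrite -big_mkcondr /=.
rewrite (eq_bigl (fun k => k <= logn p n)%N) => [|k]; last first.
  rewrite -pfactor_dvdn //; apply: andb_idl; exact: dvdn_leq.
have ln : (logn p n <= n)%N by rewrite ltnW // ltn_logl.
have := @big_nat_widen R 0 +%R 1 (logn p n).+1 n.+1 predT (fun=> 1).
rewrite ltnS /= => /(_ ln) <-; by rewrite sumr_const_nat subn1.
Qed.

Lemma mangoldt_le_ln (n : nat) : (0 < n)%N -> mangoldt n <= ln n%:R.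
Proof.
move=> n0; rewrite -sum_mangoldt_dvd // big_mkcond big_nat_recr //= dvdnn lerDr.
by apply: sumr_ge0 => d _; case: ifP => // _; exact: mangoldt_ge0.
Qed.

Lemma ln_le_mangoldt_prime (p : nat) : prime p -> ln p%:R <= mangoldt p.
Proof.
move=> pp; rewrite /mangoldt big_mkcond big_nat_recr ?prime_gt0 //= pp.
rewrite -[leLHS]add0r lerD //.
  by apply: sumr_ge0 => i _; case: ifP => // _; apply: sumr_ge0 => k _; exact: ln_nat_ge0.
rewrite big_mkcond big_ltn ?ltnS ?prime_gt0 //= expn1 eqxx lerDl.
by apply: sumr_ge0 => k _; case: ifP => // _; exact: ln_nat_ge0.
Qed.

Definition psi (n : nat) : R := \sum_(1 <= d < n.+1) mangoldt d.

(** The free upper limit [N] lets [ln n!] and [ln (2n)!] be expanded over the same range of [d]; the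
    terms with [d > n] vanish. *)
Lemma ln_fact (n N : nat) : (n <= N)%N ->
  ln n`!%:R = \sum_(1 <= d < N.+1) mangoldt d * (n %/ d)%:R.
Proof.
move=> nN; rewrite fact_prod big_nat_cond ln_prod_nat => [|i]; last by case/andP=> /andP[].
rewrite -big_nat_cond.
transitivity (\sum_(1 <= m < n.+1) \sum_(1 <= d < N.+1 | (d %| m)%N) mangoldt d).
  apply: eq_big_nat => m /andP[m0 mn]; rewrite -sum_mangoldt_dvd //.
  rewrite (big_nat_widen _ _ N.+1); last exact: leq_trans mn _.
  by apply: eq_bigl => d; apply: andb_idr => /dvdn_leq; rewrite ltnS; apply.
rewrite (exchange_big_dep_nat predT) //=; apply: eq_bigr => d _.
by rewrite divn_count_dvd natr_sum mulr_sumr big_mkcond /=; apply: eq_bigr => m _;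
  case: ifP; rewrite ?mulr1 ?mulr0.
Qed.

Lemma bin_le_exp2 (n m : nat) : ('C(n, m) <= 2 ^ n)%N.
Proof.
elim: n m => [|n IH] [|m] //; first by rewrite bin0 expn_gt0.
by rewrite binS expnS mul2n -addnn leq_add.
Qed.

Lemma exp2_le_central_bin (n : nat) : (2 ^ n <= 'C(n + n, n))%N.
Proof.
elim: n => [//|n IH]; rewrite addSn addnS binS expnS mul2n -addnn.
have -> : 'C((n + n).+1, n.+1) = 'C((n + n).+1, n).
  by rewrite -bin_sub ?subSS ?addnK // ltnS leq_addl.
by rewrite leq_add // (leq_trans IH) // leq_bin2l.
Qed.

Lemma ln_central_bin (n : nat) :
  ln 'C(n + n, n)%:R =
  \sum_(1 <= d < (n + n).+1) mangoldt d * (((n + n) %/ d)%:R - 2 * (n %/ d)%:R).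
Proof.
under eq_bigr do rewrite mulrBr mulrCA.
rewrite sumrB -mulr_sumr -!ln_fact ?leq_addl //.
rewrite -(bin_fact (leq_addl n n)) addnK !natrM.
have f0 : (n`!%:R : R) \is Num.pos by rewrite posrE ltr0n fact_gt0.
by rewrite !lnM ?rpredM // ?posrE ?ltr0n ?bin_gt0 ?leq_addl //; ring.
Qed.

(** Chebyshev's argument: in [ln 'C(2n, n)] the coefficient of [mangoldt d] is 0 or 1, and it is 1
    when [n < d <= 2n]. Both bounds follow from [2 ^ n <= 'C(2n, n) <= 4 ^ n]. *)
Lemma psi_double (n : nat) :
  psi (n + n) - psi n <= n%:R * (2 * ln 2) /\ n%:R * ln 2 <= psi (n + n).
Proof.
have b0 : (0 < 'C(n + n, n))%N by rewrite bin_gt0 leq_addl.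
split.
  apply: le_trans (_ : ln 'C(n + n, n)%:R <= _); last first.
    apply: (le_trans (ler_ln_nat _ _ b0 (bin_le_exp2 _ _))).
    by rewrite natrX lnXn // mulrnDr -mulr_natl; lra.
  rewrite ln_central_bin /psi (@big_cat_nat _ _ _ n.+1 1) ?ltnS ?leq_addl //=.
  rewrite addrC addrK [X in _ <= X](@big_cat_nat _ _ _ n.+1) ?ltnS ?leq_addl //=.
  rewrite -[X in X <= _]add0r lerD //.
    apply: sumr_ge0 => d _; apply: mulr_ge0; first exact: mangoldt_ge0.
    have [->|d0] := posnP d; first by rewrite !divn0 mulr0 subrr.
    by rewrite subr_ge0 -natrM ler_nat leq_divRL //; have := leq_divM n d; lia.
  apply: ler_sum_nat => d /andP[nd dn]; rewrite [(n %/ d)%N]divn_small // mulr0 subr0.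
  rewrite ler_peMr ?mangoldt_ge0 // ler1n divn_gt0 //; exact: leq_ltn_trans nd.
apply: le_trans (_ : ln 'C(n + n, n)%:R <= _).
  apply: (le_trans _ (ler_ln_nat _ _ _ (exp2_le_central_bin _))); rewrite ?expn_gt0 //.
  by rewrite natrX lnXn // mulr_natl.
rewrite ln_central_bin; apply: ler_sum_nat => d /andP[d0 _].
rewrite ler_piMr ?mangoldt_ge0 // lerBlDr -natrM nat1r ler_nat.
have := divn_eq n d; have := ltn_pmod n d0; move: (n %/ d)%N (n %% d)%N => q r rd ->.
rewrite -ltnS ltn_divLR //; nia.
Qed.

(** Induction by halving. For [n = 2h] or [n = 2h + 1], the three contributions are at most [4h] by
    induction, [2h] by doubling, and [2h] for the possible last term [mangoldt n <= ln n]. *)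
Lemma psi_le (n : nat) : psi n <= 4 * n%:R.
Proof.
elim/ltn_ind: n => n IH.
have l2 : ln 2 <= 1 :> R by have := ln_le_self 2; rewrite /= addr0; lra.
have [->|n0] := posnP n; first by rewrite /psi big_nil mulr0.
have IHh := IH n./2; have [hd _] := psi_double n./2.
have nE := odd_double_half n; rewrite -addnn in nE.
move: (odd n) nE IHh hd n0 {IH} => b; move: (n./2) => h <- {n} IHh hd n0.
have h0 : 0 <= h%:R :> R by [].
have {}IHh : psi h <= 4 * h%:R by apply: IHh; lia.
case: b n0 => n0; last by rewrite add0n natrD; nra.
have -> : psi (true + (h + h)) = psi (h + h) + mangoldt (h + h).+1.
  by rewrite /psi add1n big_nat_recr.
have := mangoldt_le_ln (h + h).+1 n0; have := ln_le_self (h + h).+1.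
by rewrite /= addr0 add1n -natr1 natrD; nra.
Qed.

(** Replacing [n / d] by its integer part plus one bounds [n] times the sum by [ln n! + psi n],
    hence by [n * ln n + 4 * n]. *)
Lemma mertens_mangoldt (n : nat) : (0 < n)%N ->
  \sum_(1 <= d < n.+1) mangoldt d / d%:R <= ln n%:R + 4 :> R.
Proof.
move=> n0; have n0' : 0 < n%:R :> R by rewrite ltr0n.
rewrite -(ler_pM2l n0') mulr_sumr.
apply: le_trans (_ : \sum_(1 <= d < n.+1) (mangoldt d * (n %/ d)%:R + mangoldt d) <= _).
  apply: ler_sum_nat => d /andP[d0 _].
  rewrite -[X in _ + X]mulr1 -mulrDr mulrCA ler_wpM2l ?mangoldt_ge0 // natr1.
  by rewrite ler_pdivrMr ?ltr0n // -natrM ler_nat ltnW // ltn_ceil.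
rewrite big_split /= -ln_fact // mulrDr lerD //; last by rewrite mulrC psi_le.
rewrite fact_prod big_nat_cond ln_prod_nat => [|i]; last by case/andP=> /andP[].
rewrite -big_nat_cond; apply: le_trans (_ : \sum_(1 <= i < n.+1) ln n%:R <= _).
  by apply: ler_sum_nat => i /andP[i0 ?]; exact: ler_ln_nat.
by rewrite sumr_const_nat subn1 /= mulr_natl.
Qed.

Lemma mertens_prime (n : nat) : (0 < n)%N ->
  \sum_(1 <= p < n.+1 | prime p) ln p%:R / p%:R <= ln n%:R + 4 :> R.
Proof.
move=> n0; apply: le_trans (mertens_mangoldt _ n0); rewrite big_mkcond /=.
apply: ler_sum => p _; case: ifP => [pp|_].
  by rewrite ler_pM2r ?invr_gt0 ?ltr0n ?prime_gt0 // ln_le_mangoldt_prime.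
by rewrite divr_ge0 ?mangoldt_ge0.
Qed.

End Mangoldt.

(** * Sums over primes and the upper bound for moments of omega *)

Section PrimeSum.
Context {R : realType}.

Lemma ln_le_sub1 (x : R) : 0 < x -> ln x <= x - 1.
Proof.
move=> x0; have {1}-> : x = 1 + (x - 1) by ring.
by apply: le_ln1Dx; rewrite ltrBrDl subrr.
Qed.

Definition prime_sum (n : nat) : R := \sum_(1 <= p < n.+1 | prime p) p%:R^-1.

(* Partial summation: passing from [n] to [n.+1] changes the left-hand side by
   [A n * (1 / ln n - 1 / ln n.+1)], where [A n], the sum of [ln p / p], is at
   most [ln n + 4]. *)
Lemma prime_sum_abel (n : nat) : (1 < n)%N ->
  prime_sum n - (\sum_(1 <= p < n.+1 | prime p) ln p%:R / p%:R) / ln n%:R <=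
  ln (ln n%:R) - ln (ln 2) + 4 * ((ln 2)^-1 - (ln n%:R)^-1).
Proof.
elim: n => [//|n IH]; rewrite ltnS leq_eqVlt => /predU1P[<-|n1].
  have E (F : nat -> R) : \sum_(1 <= p < 3 | prime p) F p = F 2%N.
    by rewrite unlock /= addr0.
  rewrite /prime_sum !E -[_ / _ / _]mulrA mulrCA divff ?gt_eqF ?ln_nat_gt0 //.
  by rewrite mulr1 !subrr mulr0 addr0.
have {IH} := IH n1.
rewrite /prime_sum [X in _ -> X - _ <= _]big_mkcond big_nat_recr //= -big_mkcond.
rewrite [X in _ -> _ - X / _ <= _]big_mkcond big_nat_recr //= -big_mkcond.
have a0 := @ln_nat_gt0 R n n1; have b0 := @ln_nat_gt0 R n.+1 (ltnW n1).
have hA := @mertens_prime R n (ltnW n1); move: hA.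
set A := \sum_(_ <= _ < _ | _) _; set S := \sum_(_ <= _ < _ | _) _ => hA.
set a := ln n%:R in a0 hA *; set b := ln n.+1%:R in b0 *; move=> IH.
have -> : S + (if prime n.+1 then n.+1%:R^-1 else 0) -
    (A + (if prime n.+1 then b / n.+1%:R else 0)) / b = S - A / b.
  case: ifP => _; last by rewrite !addr0.
    by rewrite [b / _]mulrC mulrDl mulfK ?gt_eqF //; ring.
have ab : b^-1 <= a^-1 by rewrite lef_pV2 ?posrE // ler_ln_nat // ltnW.
have : ln (a / b) <= a / b - 1 by apply: ln_le_sub1; rewrite divr_gt0.
rewrite ln_div ?posrE // => h.
have haa : a * a^-1 = 1 by rewrite divff // gt_eqF.
have : A * (a^-1 - b^-1) <= (a + 4) * (a^-1 - b^-1).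
  by apply: ler_wpM2r hA; rewrite subr_ge0.
lra.
Qed.

Lemma prime_sum_le : exists C : R, forall n : nat, (1 < n)%N ->
  prime_sum n <= ln (ln n%:R) + C.
Proof.
exists (1 - ln (ln 2) + 4 / ln 2) => n n1.
have := prime_sum_abel n n1; have := @mertens_prime R n (ltnW n1).
set A := \sum_(_ <= _ < _ | _) _ => hA.
have a0 := @ln_nat_gt0 R n n1.
have : A / ln n%:R <= 1 + 4 / ln n%:R.
  by rewrite ler_pdivrMr // mulrDl divfK ?gt_eqF // mul1r.
lra.
Qed.

Lemma sum_le_inj (I J : eqType) (r : seq I) (s : seq J) (h : I -> J)
    (F : I -> R) (K : J -> R) : uniq r -> uniq s -> {in r &, injective h} ->
  (forall i, i \in r -> h i \in s /\ F i <= K (h i)) ->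
  (forall j, j \in s -> 0 <= K j) ->
  \sum_(i <- r) F i <= \sum_(j <- s) K j.
Proof.
move=> ur us hinj FK K0.
apply: le_trans (_ : \sum_(j <- [seq h i | i <- r]) K j <= _).
  by rewrite big_map; apply: ler_sum_seq => i ir; case: (FK i ir).
rewrite [leRHS](bigID (fun j => j \in [seq h i | i <- r])) /=.
rewrite -[leLHS]addr0 lerD //; last by rewrite big_seq_cond sumr_ge0 // => j /andP[/K0].
rewrite -[leRHS]big_filter le_eqVlt; apply/orP; left; apply/eqP; apply: perm_big.
apply: uniq_perm; rewrite ?map_inj_in_uniq ?filter_uniq // => j.
rewrite mem_filter; apply/idP/andP => [jr|[]//]; split=> //.
by case/mapP: jr => i ir ->; case: (FK i ir).
Qed.

(** * Euler products for sums of [z ^ omega m / m] *)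

Lemma geometric_prime_le (p n : nat) : (1 < p)%N ->
  \sum_(1 <= a < n.+1) p%:R ^- a <= (p%:R - 1)^-1 :> R.
Proof.
move=> p1; have p1' : 1 < p%:R :> R by rewrite ltr1n.
have q0 : 0 < p%:R - 1 :> R by rewrite subr_gt0.
suff -> : \sum_(1 <= a < n.+1) p%:R ^- a = (1 - p%:R ^- n) / (p%:R - 1) :> R.
  rewrite ler_pdivrMr // mulVf ?gt_eqF // gerBl invr_ge0 exprn_ge0 //.
elim: n => [|n IH]; first by rewrite big_geq // expr0 invr1 subrr mul0r.
have p0 : p%:R != 0 :> R by rewrite gt_eqF // (lt_trans ltr01).
rewrite big_nat_recr //= IH exprS invfM; field.
by apply/and3P; split; rewrite ?expf_neq0 // gt_eqF.
Qed.

Lemma size_primes_split (p m : nat) : prime p -> (0 < m)%N ->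
  size (primes m) = ((0 < logn p m) + size (primes m`_p^'))%N.
Proof.
move=> pp m0; rewrite primes_part size_filter -(count_predC (pred1 p)).
by rewrite count_uniq_mem ?primes_uniq // logn_gt0.
Qed.

(** Induction on [y]. When [p = y + 1] is prime, [m] splits injectively into its exponent at [p] and
    its [p]-free part, which is still at most [n]; the powers of [p] sum to at most
    [1 + z / (p - 1)]. *)
Lemma smooth_sum_le (z : R) (n y : nat) : 0 <= z ->
  \sum_(1 <= m < n.+1 | all (fun q => q <= y)%N (primes m))
     z ^+ size (primes m) / m%:R <=
  \prod_(1 <= p < y.+1 | prime p) (1 + z / (p%:R - 1)).
Proof.
move=> z0; have h0 m : 0 <= z ^+ size (primes m) / m%:R :> R.
  by rewrite divr_ge0 ?exprn_ge0.
elim: y => [|y IH].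
  rewrite [leRHS]big_geq //; case: n => [|n]; first by rewrite big_geq.
  rewrite big_ltn_cond //= expr0 invr1 mulr1 big_nat_cond big1 ?addr0 // => m.
  move=> /andP[/andP[m2 _]]; case E : (primes m) => [|q s].
    by move: (primes_eq0 m); rewrite E ltnNge m2.
  have : q \in primes m by rewrite E mem_head.
  by rewrite mem_primes => /and3P[/prime_gt0]; case: q {E}.
rewrite [leRHS]big_mkcond [leRHS]big_nat_recr //= -[X in _ <= X * _]big_mkcond /=.
case: ifPn => [pp|npp]; last first.
  rewrite mulr1; apply: le_trans IH; rewrite le_eqVlt; apply/orP; left; apply/eqP.
  apply: eq_bigl => m; apply: eq_in_all => q; rewrite mem_primes => /andP[qp _].
  by rewrite leq_eqVlt ltnS orb_idl // => /eqP qy; rewrite -qy qp in npp.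
set p := y.+1 in pp *.
apply: le_trans (_ : (\sum_(0 <= a < n.+1) z ^+ (0 < a)%N / p%:R ^+ a) *
   \sum_(1 <= m < n.+1 | all (fun q => q <= y)%N (primes m))
     z ^+ size (primes m) / m%:R <= _); last first.
  rewrite mulrC ler_pM // ?sumr_ge0 // => [a _|].
    by rewrite divr_ge0 ?exprn_ge0.
  rewrite big_ltn // expr0 invr1 mulr1 lerD2l.
  under eq_big_nat => a /andP[a0 _] do rewrite a0 expr1.
  by rewrite -mulr_sumr ler_wpM2l // geometric_prime_le // prime_gt1.
rewrite -[leLHS]big_filter -(big_filter _ (fun m => all _ (primes m))).
pose K (u : nat * nat) : R :=
  z ^+ (0 < u.1)%N / p%:R ^+ u.1 * (z ^+ size (primes u.2) / u.2%:R).
apply: le_trans (_ : \sum_(u <- [seq (a, m) | a <- index_iota 0 n.+1,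
    m <- [seq m <- index_iota 1 n.+1 | all (fun q => q <= y)%N (primes m)]]) K u <= _);
  last by rewrite big_allpairs big_distrlr.
apply: (sum_le_inj _ _ _ _ (fun m => (logn p m, partn m p^')) _ K).
- by rewrite filter_uniq // iota_uniq.
- by rewrite allpairs_uniq ?filter_uniq ?iota_uniq // => -[? ?] [? ?].
- move=> m m'; rewrite !mem_filter !mem_index_iota.
  move=> /andP[_ /andP[m0 _]] /andP[_ /andP[m0' _]] [lE pE].
  by rewrite -(partnC p m0) -(partnC p m0') !p_part lE pE.
- move=> m; rewrite mem_filter mem_index_iota => /andP[sm /andP[m0 mn]].
  split.
    apply/allpairsP; exists (logn p m, partn m p^') => /=; split=> //.
      by rewrite mem_index_iota /= (leq_trans (ltn_logl p m0)) // ltnW.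
    rewrite mem_filter mem_index_iota part_gt0 /= ltnS; apply/andP; split; last first.
      by apply: leq_trans (mn : (m <= n)%N); rewrite dvdn_leq // dvdn_part.
    apply/allP => q; rewrite primes_part mem_filter => /andP[qp qm].
    have := allP sm _ qm; rewrite leq_eqVlt => /predU1P[qE|//].
    by move: qp; rewrite /= !inE qE eqxx.
  rewrite /K (size_primes_split p m) //= exprD.
  have -> : m%:R = p%:R ^+ logn p m * (partn m p^')%:R :> R.
    by rewrite -natrX -natrM -p_part partnC.
  by rewrite invfM mulrACA.
- by move=> u _; rewrite /K mulr_ge0 // divr_ge0 // exprn_ge0.
Qed.

Lemma sum_pred_prime_le (n : nat) :
  \sum_(1 <= p < n.+1 | prime p) (p%:R - 1)^-1 <= prime_sum n + 1.
Proof.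
(* The differences [1 / (m - 1) - 1 / m] telescope over all [m] from 2 to [n] to [1 - 1 / n]; the
   induction needs this sharper form. *)
suff : \sum_(1 <= p < n.+1 | prime p) (p%:R - 1)^-1 <=
    prime_sum n + 1 - (if n is 0 then 1 else n%:R^-1).
  by move=> /le_trans; apply; rewrite gerBl; case: n => // n; rewrite invr_ge0.
rewrite /prime_sum; elim: n => [|[|n] IH].
- by rewrite !big_geq // add0r subrr.
- by rewrite unlock /= invr1 add0r subrr.
rewrite big_mkcond big_nat_recr //= -big_mkcond /=.
rewrite [X in _ <= X + _ - _]big_mkcond big_nat_recr //= -[X in _ <= X + _ + _ - _]big_mkcond /=.
have : 0 < n.+1%:R :> R by rewrite ltr0n.
move: IH => /=; set A := \sum_(_ <= _ < _ | _) _; set S := \sum_(_ <= _ < _ | _) _.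
rewrite -[n.+2%:R]natr1 addrK; set t := n.+1%:R => IH t0.
have t10 : 0 < t + 1 by rewrite addr_gt0.
have : (t + 1)^-1 <= t^-1 by rewrite lef_pV2 ?posrE // lerDl.
move: IH; move: (t^-1) ((t + 1)^-1) => a b IH ba; clearbody A S.
by case: ifP => _; [move: IH | move: IH ba]; lra.
Qed.

Lemma euler_sum_le (z : R) (n : nat) : 0 <= z ->
  \sum_(1 <= m < n.+1) z ^+ size (primes m) / m%:R <=
  expR (z * (prime_sum n + 1)).
Proof.
move=> z0; apply: le_trans (_ : \prod_(1 <= p < n.+1 | prime p) (1 + z / (p%:R - 1)) <= _).
  apply: le_trans (smooth_sum_le z n n z0).
  rewrite big_nat_cond [leRHS]big_nat_cond le_eqVlt; apply/orP; left; apply/eqP.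
  apply: eq_bigl => m; rewrite andbT; apply/esym/andb_idr => /andP[m0 mn].
  apply/allP => q; rewrite mem_primes => /and3P[_ _ /dvdn_leq qm].
  exact: leq_trans (qm m0) _.
apply: le_trans (_ : expR (z * \sum_(1 <= p < n.+1 | prime p) (p%:R - 1)^-1) <= _).
  rewrite mulr_sumr expR_sum; apply: ler_prod => p pp.
  rewrite expR_ge1Dx andbT addr_ge0 // divr_ge0 // subr_ge0 ler1n prime_gt0 //.
by rewrite ler_expR ler_wpM2l // sum_pred_prime_le.
Qed.

(** At [z = 1] the Euler product bounds the harmonic sum by [exp (prime_sum n + 1)], while the
    harmonic sum is at least [ln (n + 1)]. *)
Lemma prime_sum_ge (n : nat) : (0 < n)%N ->
  ln (ln n.+1%:R) - 1 <= prime_sum n.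
Proof.
move=> n0; rewrite lerBlDr -ler_expR lnK; last by rewrite posrE ln_nat_gt0.
have := euler_sum_le 1 n ler01; rewrite mul1r; apply: le_trans.
under eq_bigr do rewrite expr1n div1r.
elim: n {n0} => [|n IH]; first by rewrite big_geq // ln1.
rewrite big_nat_recr //=; have n0 : 0 < n.+1%:R :> R by rewrite ltr0n.
have -> : n.+2%:R = n.+1%:R * (1 + n.+1%:R^-1) :> R.
  by rewrite mulrDr mulr1 divff ?gt_eqF // natr1.
have i0 : 0 < n.+1%:R^-1 :> R by rewrite invr_gt0.
have i1 : 0 < 1 + n.+1%:R^-1 :> R by rewrite addr_gt0.
rewrite lnM ?posrE //; by rewrite lerD // le_ln1Dx // (lt_trans _ i0) // ltrN10.
Qed.

Lemma sum_multiples (F : nat -> R) (d n : nat) : (0 < d)%N ->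
  \sum_(1 <= m < n.+1 | (d %| m)%N) F (m %/ d)%N =
  \sum_(1 <= j < n.+1 | (d * j <= n)%N) F j.
Proof.
move=> d0; transitivity (\sum_(1 <= m < n.+1)
    \sum_(1 <= j < n.+1 | (d * j)%N == m) F j).
  rewrite big_mkcond /=; apply: eq_big_nat => m /andP[m0 mn]; case: ifPn => dm.
    rewrite (eq_bigl (fun j => j == m %/ d)%N) => [|j]; last first.
      by rewrite eq_sym eqn_div // mulnC eq_sym.
    rewrite big_nat1_eq divn_gt0 // dvdn_leq //= ifT //.
    by apply: leq_ltn_trans mn; exact: leq_div.
  rewrite big1 // => j /eqP jm; move: dm; rewrite -jm dvdn_mulr //.
rewrite (exchange_big_dep_nat predT) //= [RHS]big_mkcond /=.
apply: eq_big_nat => j /andP[j0 _]; under eq_bigl do rewrite eq_sym.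
by rewrite big_nat1_eq muln_gt0 d0 j0 ltnS.
Qed.

(* [ln m] is the sum of [mangoldt d] over the divisors [d] of [m], and
   [z ^+ omega m <= z ^+ omega (m / d)]. *)
Lemma sum_pow_omega_ln (z : R) (n : nat) : 0 <= z <= 1 ->
  \sum_(1 <= m < n.+1) z ^+ size (primes m) * ln m%:R <=
  4 * n%:R * \sum_(1 <= m < n.+1) z ^+ size (primes m) / m%:R.
Proof.
move=> /andP[z0 z1].
apply: le_trans (_ : \sum_(1 <= m < n.+1) \sum_(1 <= d < n.+1 | (d %| m)%N)
    mangoldt d * z ^+ size (primes (m %/ d)) <= _).
  apply: ler_sum_nat => m /andP[m0 mn]; rewrite -sum_mangoldt_dvd // mulr_sumr.
  rewrite (big_nat_widen 1 m.+1 n.+1) // big_mkcond [leRHS]big_mkcond /=.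
  apply: ler_sum => d _; case: ifPn => [/andP[dm _]|_]; last first.
    by case: ifP => // _; rewrite mulr_ge0 ?exprn_ge0 ?mangoldt_ge0.
  rewrite dm mulrC ler_wpM2l ?mangoldt_ge0 // ler_wiXn2l //.
  apply: uniq_leq_size; first exact: primes_uniq.
  move=> q; rewrite !mem_primes m0 => /and3P[-> _ /dvdn_trans]; apply.
  by rewrite -{2}(divnK dm) dvdn_mulr.
rewrite (exchange_big_dep_nat predT) //=.
under eq_big_nat => d /andP[d0 _].
  rewrite -mulr_sumr (sum_multiples (fun j => z ^+ size (primes j))) // mulr_sumr.
  over.
rewrite (exchange_big_dep_nat predT) //= mulr_sumr; apply: ler_sum_nat => j /andP[j0 jn].
have -> : 4 * n%:R * (z ^+ size (primes j) / j%:R) =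
  4 * (n%:R / j%:R) * z ^+ size (primes j) by ring.
rewrite -mulr_suml.
rewrite ler_wpM2r ?exprn_ge0 //.
have -> : \sum_(1 <= d < n.+1 | (d * j <= n)%N) mangoldt d = psi (n %/ j) :> R.
  rewrite /psi (big_nat_widen _ (n %/ j).+1 n.+1) ?ltnS ?leq_div //.
  by apply: eq_bigl => d; rewrite /= ltnS leq_divRL.
apply: (le_trans (psi_le _)); rewrite ler_wpM2l // ler_pdivlMr ?ltr0n //.
by rewrite -natrM ler_nat leq_divM.
Qed.

Lemma sum_pow_omega_le : exists2 C : R, 0 < C &
  forall (z : R) (n : nat), 0 <= z <= 1 -> (1 < n)%N ->
  \sum_(1 <= m < n.+1) z ^+ size (primes m) <=
  C * (n%:R / ln n%:R) * expR (z * ln (ln n%:R)).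
Proof.
have [C0 hC0] := prime_sum_le.
exists (5 * expR `|C0 + 1|); first by rewrite mulr_gt0 ?expR_gt0.
move=> z n z01 n1; have n0 := ltnW n1; have /andP[z0 z1] := z01.
have lnn := @ln_nat_gt0 R n n1.
set T := \sum_(1 <= m < n.+1) z ^+ size (primes m) / m%:R.
have hT : T <= expR (z * ln (ln n%:R)) * expR `|C0 + 1|.
  apply: (le_trans (euler_sum_le z n z0)); rewrite -expRD ler_expR.
  have : z * (prime_sum n + 1) <= z * (ln (ln n%:R) + (C0 + 1)).
    by rewrite ler_wpM2l // addrA lerD2r hC0.
  have : z * (C0 + 1) <= `|C0 + 1|.
    apply: (le_trans (ler_norm _)); rewrite normrM ger0_norm //.
    by rewrite ler_piMl.
  lra.
(* From [ln n <= ln m + n / m]: the first term costs [4 * n * T] and the second [n * T], whence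
   5. *)
have key : ln n%:R * \sum_(1 <= m < n.+1) z ^+ size (primes m) <= 5 * n%:R * T.
  apply: le_trans (_ : \sum_(1 <= m < n.+1) z ^+ size (primes m) * ln m%:R +
    n%:R * T <= _); last first.
    have := sum_pow_omega_ln z n z01; rewrite -/T; lra.
  rewrite /T !mulr_sumr -big_split /=; apply: ler_sum_nat => m /andP[m0 mn].
  have m0' : 0 < m%:R :> R by rewrite ltr0n.
  have n0' : 0 < n%:R :> R by rewrite ltr0n.
  have -> : z ^+ size (primes m) * ln m%:R + n%:R * (z ^+ size (primes m) / m%:R) =
    (ln m%:R + n%:R / m%:R) * z ^+ size (primes m) by ring.
  rewrite ler_wpM2r ?exprn_ge0 // -lerBlDl -ln_div ?posrE //.
  by apply: (le_trans (ln_le_sub1 _ _)); rewrite ?divr_gt0 // gerBl.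
rewrite -(ler_pM2l lnn); apply: (le_trans key).
have -> : ln n%:R * (5 * expR `|C0 + 1| * (n%:R / ln n%:R) * expR (z * ln (ln n%:R))) =
  5 * n%:R * (expR (z * ln (ln n%:R)) * expR `|C0 + 1|).
  by field; rewrite gt_eqF.
by rewrite ler_wpM2l // mulr_ge0.
Qed.

End PrimeSum.

(** With [y = z ^ (1 / beta)], the term of index [k] in the exponential series at [ln 2 / y] bounds
    [1 / fact_ratio k] by [exp (ln 2 / y) * y ^ k]. Raising this to the power [beta] turns [y ^ k]
    into [z ^ k], with [z] left free for optimization. *)
Lemma G_powR_le {R : realType} (beta z : R) (n : nat) :
  0 < beta -> 0 < z -> (0 < n)%N ->
  (G n)%:R `^ (- beta) <=
  2 `^ beta * expR (beta * (ln 2 / z `^ beta^-1)) * z ^+ size (primes n).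
Proof.
move=> b0 z0 n0; set k := size _; set y := z `^ beta^-1.
have y0 : 0 < y by exact: powR_gt0.
have yb : y `^ beta = z by rewrite -powRrM mulVf ?gt_eqF // powRr1 // ltW.
clearbody y; have /andP[hG _] := @G_bounds R n n0; rewrite -/k in hG.
have f0 := @fact_ratio_gt0 R k.
have G0 : 0 < (G n)%:R :> R by apply: lt_le_trans hG; rewrite divr_gt0.
have hy : (fact_ratio k)^-1 <= expR (ln 2 / y) * y ^+ k.
  have t0 : 0 <= ln 2 / y by rewrite ltW // divr_gt0 // ln2_gt0.
  have := @exp_partial_le R (ln 2 / y) k.+1 t0; rewrite big_ord_recr /= => h.
  have {}h : (ln 2 / y) ^+ k / k`!%:R <= expR (ln 2 / y).
    apply: le_trans h; rewrite lerDr; apply: sumr_ge0 => i _.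
    by rewrite divr_ge0 // exprn_ge0.
  rewrite -ler_pdivrMr ?exprn_gt0 //; apply: le_trans h.
  by rewrite /fact_ratio invf_div expr_div_n mulrAC.
set W := 2 * (expR (ln 2 / y) * y ^+ k).
have V0 : 0 < expR (ln 2 / y) * y ^+ k by rewrite mulr_gt0 ?expR_gt0 ?exprn_gt0.
have W0 : 0 < W by rewrite mulr_gt0.
have WG : W^-1 <= (G n)%:R.
  apply: le_trans hG; rewrite /W invfM mulrC ler_pM2r ?invr_gt0 //.
  by rewrite -[leRHS]invrK lef_pV2 ?posrE ?invr_gt0.
have WE : W `^ beta = 2 `^ beta * expR (beta * (ln 2 / y)) * z ^+ k.
  have yk : (y ^+ k) `^ beta = z ^+ k.
    by rewrite -yb -(powR_mulrn k (powR_ge0 y beta)) -(powR_mulrn k (ltW y0)) -!powRrM mulrC.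
  rewrite /W (powRM beta _ (ltW V0)) // (powRM beta (expR_ge0 _)) ?exprn_ge0 ?(ltW y0) // yk mulrA.
  by congr (_ * _ * _); rewrite [in RHS]mulrC [RHS]expRM.
rewrite -WE powRN -[leRHS]invrK lef_pV2 ?posrE ?invr_gt0 ?powR_gt0 //.
have -> : (W `^ beta)^-1 = W^-1 `^ beta.
  by rewrite -powRN -(powR_inv1 (ltW W0)) -powRrM mulN1r.
apply: ge0_ler_powR => //; first exact: ltW.
- by rewrite nnegrE invr_ge0 ltW.
- by rewrite nnegrE ltW.
Qed.

(** * Products of distinct primes *)

Section SquarefreeCount.
Context {R : realType}.

Definition prime_count (n : nat) : nat := (\sum_(1 <= p < n.+1 | prime p) 1)%N.

(** A prime [p] contributes [l * ln p = ln (p ^ l)], where [p ^ l] is its largest power not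
    exceeding [n]. *)
Lemma psi_le_prime_count (n : nat) : psi n <= (prime_count n)%:R * ln n%:R :> R.
Proof.
rewrite /psi; under eq_bigr do rewrite -[mangoldt _]mul1r.
rewrite (sum_mangoldt (fun=> 1)) natr_sum mulr_suml.
have [->|n0] := posnP n; first by rewrite !big_geq.
rewrite big_nat_cond [leRHS]big_nat_cond; apply: ler_sum => p /andP[_ pp].
have p1 := prime_gt1 pp; have /andP[pl _] := trunc_log_bounds p1 n0.
set l := trunc_log p n in pl.
apply: le_trans (_ : \sum_(1 <= k < n.+1 | (k < l.+1)%N) ln p%:R <= _).
  rewrite big_mkcond [leRHS]big_mkcond; apply: ler_sum => k _; rewrite mul1r.
  case: ifP => [pk|_]; first by rewrite ltnS trunc_log_max.
  by case: ifP => // _; exact: ln_nat_ge0.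
have len : (l <= n)%N by apply: ltnW; apply: leq_trans pl; exact: ltn_expl.
have := @big_nat_widen R 0 +%R 1 l.+1 n.+1 predT (fun=> ln p%:R).
rewrite ltnS /= => /(_ len) <-; rewrite sumr_const_nat subn1 /=.
rewrite -lnXn ?ltr0n ?prime_gt0 // -natrX mul1r; apply: ler_ln_nat => //.
by rewrite expn_gt0 prime_gt0.
Qed.

Lemma prime_count_ge (n : nat) : (1 < n)%N ->
  ln 2 / 3 * (n%:R / ln n%:R) <= (prime_count n)%:R :> R.
Proof.
move=> n1; have lnn := @ln_nat_gt0 R n n1.
rewrite mulrA ler_pdivrMr //; apply: le_trans (psi_le_prime_count n).
have [_ h] := @psi_double R n./2.
apply: le_trans (_ : psi (n./2 + n./2) <= _); last first.
  have hn : (n./2 + n./2 <= n)%N by rewrite addnn -{2}(odd_double_half n) leq_addl.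
  rewrite /psi [leRHS](@big_cat_nat _ _ _ (n./2 + n./2).+1) //= lerDl.
  by apply: sumr_ge0 => d _; exact: mangoldt_ge0.
apply: le_trans h; rewrite [leRHS]mulrC -mulrA ler_wpM2l ?(ltW ln2_gt0) //.
(* The constant 3 comes from [n <= 3 * n./2] for [n >= 2], with equality at [n = 3]. *)
rewrite mulrC ler_pdivrMr // -natrM ler_nat.
have := odd_double_half n; rewrite -addnn; case: (odd n) => /= nE; lia.
Qed.

(** * Lower bound for elementary symmetric functions *)

Section ElementarySymmetric.
Context {I : finType} (a : I -> R) (a01 : forall i, 0 <= a i <= 1).

Definition elem_sym (j : nat) : R := \sum_(A : {set I} | #|A| == j) \prod_(i in A) a i.

Let prod_ge0 (A : {set I}) : 0 <= \prod_(i in A) a i.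
Proof. by apply: prodr_ge0 => i _; case/andP: (a01 i). Qed.

(** Marking one element of each [(j + 1)]-set writes the right-hand side as a sum over [j]-sets [A]
    and [i] outside [A]. The sum of [a i] outside [A] is at least the total minus [j], because
    [a i <= 1]. *)
Lemma elem_sym_rec (j : nat) :
  ((\sum_i a i) - j%:R) * elem_sym j <= j.+1%:R * elem_sym j.+1.
Proof.
have -> : j.+1%:R * elem_sym j.+1 =
    \sum_(A : {set I} | #|A| == j) \sum_(i | i \notin A) a i * \prod_(i in A) a i.
  transitivity (\sum_(B : {set I} | #|B| == j.+1) \sum_(i in B) \prod_(k in B) a k).
    rewrite /elem_sym mulr_sumr; apply: eq_bigr => B /eqP Bj.
    by rewrite sumr_const Bj mulr_natl.
  rewrite (exchange_big_dep predT) //= [RHS](exchange_big_dep predT) //=.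
  apply: eq_bigr => i _.
  rewrite (reindex_onto (fun A : {set I} => i |: A) (fun B => B :\ i)) /=; last first.
    by move=> B /andP[_ iB]; rewrite finset.setD1K.
  apply: eq_big => [A|A].
    rewrite finset.setU11 andbT cardsU1.
    case iA : (i \in A) => /=; last by rewrite add1n eqSS finset.setU1K ?iA // eqxx andbT.
    rewrite andbF andbC; case: eqP => //= E.
    by move: iA; rewrite -E !inE eqxx.
  move=> /andP[_ /eqP E]; have iA : i \notin A by rewrite -E !inE eqxx.
  by rewrite big_setU1.
rewrite /elem_sym mulr_sumr; apply: ler_sum => A /eqP Aj.
rewrite -mulr_suml ler_wpM2r // (bigID (mem A)) /= addrAC gerDr subr_le0.
rewrite -Aj -sumr_const; apply: ler_sum => i _; by case/andP: (a01 i).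
Qed.

Lemma elem_sym_ge (j : nat) : j%:R <= \sum_i a i ->
  (\sum_i a i - j%:R) ^+ j / j`!%:R <= elem_sym j.
Proof.
(* Keeping [j] fixed and inducting on [i <= j] allows each factor, the total minus [i], to be
   replaced by the smaller nonnegative total minus [j]. *)
move=> jS; suff H i : (i <= j)%N -> (\sum_i a i - j%:R) ^+ i / i`!%:R <= elem_sym i.
  exact: H.
elim: i => [_|i IH ij].
  rewrite /elem_sym expr0 fact0 divr1 (bigD1 finset.set0) ?cards0 //= big_set0 lerDl.
  by apply: sumr_ge0 => A _.
have {}IH := IH (ltnW ij).
have i0 : 0 < i.+1%:R :> R by rewrite ltr0n.
rewrite -(ler_pM2l i0); apply: le_trans (elem_sym_rec i).
rewrite factS natrM invfM exprS mulrCA [_ * (i.+1%:R^-1 * _)]mulrA mulfV ?gt_eqF //.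
rewrite mul1r -mulrA; apply: ler_pM => //; rewrite ?subr_ge0 //.
  by rewrite divr_ge0 ?exprn_ge0 ?subr_ge0.
by rewrite lerD2l lerN2 ler_nat ltnW.
Qed.

End ElementarySymmetric.

(** * Counting squarefree integers with a prescribed number of primes *)

Lemma logn_prod_distinct_primes (s : seq nat) (q : nat) : uniq s -> all prime s ->
  logn q (\prod_(d <- s) d) = (q \in s).
Proof.
elim: s => [|d s IH] /=; first by rewrite big_nil logn1.
move=> /andP[ds us] /andP[dp sp]; have s0 : (0 < \prod_(e <- s) e)%N.
  by rewrite big_seq prodn_cond_gt0 // => e /(allP sp); exact: prime_gt0.
rewrite big_cons (lognM _ (prime_gt0 dp) s0).
rewrite logn_prime // IH // inE; by case: eqVneq => [->|_]; rewrite ?(negbTE ds).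
Qed.

Lemma primes_prod_distinct_primes (s : seq nat) : uniq s -> all prime s ->
  perm_eq (primes (\prod_(d <- s) d)) s.
Proof.
move=> us sp; apply: uniq_perm => // [|q]; first exact: primes_uniq.
by rewrite -logn_gt0 logn_prod_distinct_primes // lt0b.
Qed.

(* The integers [n = (\prod_(i in A) i) * p], for a set [A] of [j] primes at most
   [w] and a prime [p > w ^ j], are distinct: [p] is the largest prime factor. *)
Lemma squarefree_sum_ge (f : nat -> R) (c : R) (w j N : nat) :
  0 <= c -> (forall n, 0 <= f n) ->
  (forall n, (0 < n)%N -> (forall q, (logn q n <= 1)%N) ->
     size (primes n) = j.+1 -> c <= f n) ->
  \sum_(A : {set 'I_w.+1} | (#|A| == j) && [forall i in A, prime i])
    c * ((prime_count (N %/ \prod_(i in A) i))%:R - (w ^ j)%:R) <=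
  \sum_(1 <= n < N.+1) f n.
Proof.
move=> c0 f0 fc; set Q := (w ^ j)%N.
pose sA (A : {set 'I_w.+1}) : seq nat := [seq val i | i <- enum A].
pose pA (A : {set 'I_w.+1}) : nat := (\prod_(i in A) i)%N.
have pAE A : pA A = (\prod_(d <- sA A) d)%N by rewrite /sA big_map big_enum.
pose X : pred {set 'I_w.+1} := fun A => (#|A| == j) && [forall i in A, prime i].
pose ps A := [seq p <- index_iota 1 (N %/ pA A).+1 | prime p && (Q < p)%N].
pose r := [seq (A, p) | A <- [seq A <- index_enum {set 'I_w.+1} | X A], p <- ps A].
have sAP A : X A -> [/\ uniq (sA A), all prime (sA A), size (sA A) = j & (pA A <= Q)%N].
  move=> /andP[/eqP Aj /forall_inP Ap]; split.
  - by rewrite map_inj_uniq ?enum_uniq //; exact: val_inj.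
  - by apply/allP => q /mapP[i]; rewrite mem_enum => /Ap ? ->.
  - by rewrite size_map -cardE.
  - rewrite /Q -Aj -prod_nat_const; apply: leq_prod => i _.
    by rewrite -ltnS.
have rP A p : (A, p) \in r -> [/\ X A, prime p, (Q < p)%N & (0 < pA A * p <= N)%N].
  move=> /allpairsPdep[A' [p' [+ +]]] [-> ->]; rewrite !mem_filter mem_index_iota.
  move=> /andP[XA _] /andP[/andP[pp Qp] /andP[p0]]; rewrite ltnS => pN.
  have pA0 : (0 < pA A')%N.
    have [_ sp _ _] := sAP _ XA.
    by rewrite pAE big_seq prodn_cond_gt0 // => e /(allP sp); exact: prime_gt0.
  by split=> //; rewrite muln_gt0 pA0 p0 mulnC -leq_divRL.
have notin A p : X A -> (Q < p)%N -> p \notin sA A.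
  move=> XA Qp; have [us sp _ sQ] := sAP _ XA; apply/negP => ps'.
  have : (p %| pA A)%N.
    rewrite pAE (big_rem p ps') /= dvdn_mulr //.
  have pA0 : (0 < pA A)%N.
    by rewrite pAE big_seq prodn_cond_gt0 // => e /(allP sp); exact: prime_gt0.
  by move=> /(dvdn_leq pA0); rewrite leqNgt (leq_ltn_trans sQ).
apply: le_trans (_ : \sum_(u <- r) c <= _).
  rewrite /r big_allpairs_dep big_filter; apply: ler_sum => A XA.
  have [_ _ _ sQ] := sAP _ XA.
  rewrite big_const_seq count_predT iter_addr_0 -[c *+ _]mulr_natr ler_wpM2l // lerBlDr.
  rewrite -natrD ler_nat /prime_count sum1_count size_filter.
  set s := index_iota _ _.
  (* A prime is either above [Q] or among the [Q] integers from 1 to [Q]. *)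
  apply: leq_trans (_ : count (predU (fun p => prime p && (Q < p)%N) (fun p => p <= Q)%N) s <= _)%N.
    by apply: sub_count => p /= pp; rewrite pp /=; case: ltnP.
  apply: leq_trans (leq_addr (count (predI (fun p => prime p && (Q < p)%N) (fun p => p <= Q)%N) s) _) _.
  rewrite count_predUI leq_add2l -size_filter -[leqRHS](size_iota 1).
  apply: uniq_leq_size; first by rewrite filter_uniq // iota_uniq.
  by move=> p; rewrite mem_filter mem_index_iota mem_iota add1n => /and3P[pQ -> _] /=; rewrite ltnS.
apply: (sum_le_inj _ _ _ _ (fun u => (pA u.1 * u.2)%N)) => //.
- apply: allpairs_uniq_dep => [|A _|[A p] [B q] _ _ /= [-> ->]] //.
    by rewrite filter_uniq // index_enum_uniq.
  by rewrite filter_uniq // iota_uniq.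
- by rewrite iota_uniq.
- move=> [A p] [B q] /rP[XA pp Qp _] /rP[XB qp Qq _] /= E.
  have [uA spA _ sQA] := sAP _ XA; have [uB spB _ sQB] := sAP _ XB.
  have cons (C : {set 'I_w.+1}) (t : nat) : (pA C * t)%N = (\prod_(d <- t :: sA C) d)%N.
    by rewrite big_cons mulnC pAE.
  (* Equal products have the same prime factors. The one above [Q] must be [p] as well as [q], and
     the remaining ones determine the set. *)
  have H x : (x \in p :: sA A) = (x \in q :: sA B).
    have EA := logn_prod_distinct_primes (p :: sA A) x.
    have EB := logn_prod_distinct_primes (q :: sA B) x.
    rewrite -cons /= notin // uA pp spA in EA.
    rewrite -cons /= notin // uB qp spB -E in EB.
    have := EA isT isT; rewrite EB //; by do 2![case: (_ \in _)].
  have pq : p = q.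
    have := H p; rewrite !inE eqxx /= => /esym/orP[/eqP //|pB].
    by move: (notin B p XB Qp); rewrite pB.
  subst q; congr (_, _); apply/setP => i.
  have mem (C : {set 'I_w.+1}) : (i \in C) = (val i \in sA C).
    by rewrite mem_map ?mem_enum //; exact: val_inj.
  have := H (val i); rewrite !inE !mem.
  case: (eqVneq (val i) p) => [->|//] _.
  by rewrite (negbTE (notin A p XA Qp)) (negbTE (notin B p XB Qp)).
- move=> [A p] /rP[XA pp Qp /= /andP[n0 nN]].
  have [uA spA szA sQA] := sAP _ XA.
  have us : uniq (p :: sA A) by rewrite /= uA notin.
  have sp : all prime (p :: sA A) by rewrite /= pp.
  split; first by rewrite mem_index_iota n0 ltnS.
  have E : (pA A * p)%N = (\prod_(d <- p :: sA A) d)%N by rewrite big_cons mulnC pAE.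
  apply: fc => // [q|]; rewrite E.
    by rewrite logn_prod_distinct_primes // leq_b1.
  by rewrite (perm_size (primes_prod_distinct_primes _ us sp)) /= szA.
Qed.

Lemma ln2_bounds : 2^-1 <= ln (2 : R) <= 1.
Proof.
have := @ln_le_sub1 R 2^-1; have := @ln_le_sub1 R 2.
rewrite invr_gt0 ltr0n lnV ?posrE // => /(_ isT) h1 /(_ isT) h2.
by apply/andP; split; lra.
Qed.

(** For [m] the product over [A] and [u = N / (m * ln N)], Chebyshev gives at least [ln 2 / 6 * u]
    primes up to [N / m]. Since [m <= w ^ j], the size hypothesis makes the discarded [w ^ j] at
    most [ln 2 / 12 * u]. Summing [1 / m] over [A] produces [elem_sym]. *)
Lemma squarefree_count_ge (f : nat -> R) (c : R) (w j N : nat) :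
  0 <= c -> (forall n, 0 <= f n) ->
  (forall n, (0 < n)%N -> (forall q, (logn q n <= 1)%N) ->
     size (primes n) = j.+1 -> c <= f n) ->
  (0 < w)%N -> (1 < N)%N -> j%:R <= prime_sum w :> R ->
  12 * ((w ^ j) ^ 2)%:R * ln N%:R <= ln 2 * N%:R :> R ->
  c * (ln 2 / 12 * (N%:R / ln N%:R) * ((prime_sum w - j%:R) ^+ j / j`!%:R)) <=
  \sum_(1 <= n < N.+1) f n.
Proof.
move=> c0 f0 fc w0 N1 jS QN; apply: le_trans (squarefree_sum_ge f c w j N c0 f0 fc).
set Q := (w ^ j)%N in QN *; have Q0 : (0 < Q)%N by rewrite expn_gt0 w0.
(* Weight 0 on non-primes removes from [elem_sym] every set that is not made of primes. *)
pose a (i : 'I_w.+1) : R := if prime i then i%:R^-1 else 0.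
have a01 i : 0 <= a i <= 1.
  rewrite /a; case: ifP => [pi|_]; last by rewrite lexx ler01.
  by rewrite invr_ge0 ler0n /= invf_le1 ?ltr0n ?ler1n ?prime_gt0.
have aS : \sum_i a i = prime_sum w.
  rewrite /prime_sum -(big_mkord predT (fun i => if prime i then i%:R^-1 else 0)).
  by rewrite big_ltn //= add0r -big_mkcond.
have lnN := @ln_nat_gt0 R N N1; have /andP[l12 l21] := ln2_bounds.
have N0 : 0 < N%:R :> R by rewrite ltr0n ltnW.
have QN2 : (2 * Q <= N)%N.
  rewrite -(ler_nat R) natrM.
  have lN : 2^-1 <= ln N%:R :> R by apply: (le_trans l12); exact: ler_ln_nat.
  have Q1 : 1 <= Q%:R :> R by rewrite ler1n.
  have : 2 * Q%:R <= 12 * (Q ^ 2)%:R * ln N%:R :> R.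
    rewrite natrX expr2; apply: le_trans (_ : 12 * (Q%:R * Q%:R) * 2^-1 <= _); last first.
      by rewrite ler_wpM2l // !mulr_ge0.
    by nra.
  by nra.
apply: le_trans (_ : c * (ln 2 / 12 * (N%:R / ln N%:R) * elem_sym a j) <= _).
  rewrite ler_wpM2l // ler_wpM2l ?mulr_ge0 ?invr_ge0 ?(ltW lnN) //; first lra.
  by rewrite -aS; apply: elem_sym_ge => //; rewrite aS.
rewrite /elem_sym !mulr_sumr big_mkcond [leRHS]big_mkcond /=; apply: ler_sum => A _.
case Aj : (#|A| == j) => //=; case: ifPn => [/forall_inP Ap|nAp]; last first.
  move: nAp; rewrite negb_forall_in => /exists_inP[i iA npi].
  by rewrite (bigD1 i iA) /= /a (negbTE npi) mul0r !mulr0.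
rewrite ler_wpM2l //.
have -> : \prod_(i in A) a i = (\prod_(i in A) i)%:R^-1.
  rewrite natr_prod -prodfV; apply: eq_bigr => i /Ap pi; by rewrite /a pi.
set m := (\prod_(i in A) i)%N.
have m0 : (0 < m)%N by rewrite /m prodn_cond_gt0 // => i /Ap; exact: prime_gt0.
have mQ : (m <= Q)%N.
  rewrite /Q -(eqP Aj) -prod_nat_const; apply: leq_prod => i _.
  by rewrite -ltnS.
have M2 : (1 < N %/ m)%N by rewrite leq_divRL // (leq_trans _ QN2) // leq_mul2l mQ orbT.
set M := (N %/ m)%N in M2 *.
have MN : (M <= N)%N by exact: leq_div.
have NM : N%:R <= 2 * (M%:R * m%:R) :> R.
  rewrite -!natrM ler_nat.
  have := divn_eq N m; rewrite -/M; have := ltn_pmod N m0; nia.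
have hpi := @prime_count_ge M M2.
have m0' : 0 < m%:R :> R by rewrite ltr0n.
have lnM0 := @ln_nat_gt0 R M M2.
have lMN : ln M%:R <= ln N%:R :> R by apply: ler_ln_nat => //; exact: ltnW.
set u := N%:R / (ln N%:R * m%:R) : R.
have u0 : 0 <= u by rewrite divr_ge0 // mulr_ge0 // ltW.
have -> : ln 2 / 12 * (N%:R / ln N%:R) * m%:R^-1 = ln 2 / 12 * u :> R.
  by rewrite /u invfM !mulrA.
have h1 : u <= 2 * (M%:R / ln M%:R).
  rewrite /u ler_pdivrMr ?mulr_gt0 //; apply: (le_trans NM).
  have -> : 2 * (M%:R / ln M%:R) * (ln N%:R * m%:R) =
     2 * (M%:R * m%:R) * (ln N%:R / ln M%:R) :> R by ring.
  by rewrite ler_peMr ?mulr_ge0 // ler_pdivlMr // mul1r.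
have h2 : 12 * Q%:R <= ln 2 * u :> R.
  rewrite /u mulrA ler_pdivlMr ?mulr_gt0 //; apply: le_trans QN.
  have -> : 12 * Q%:R * (ln N%:R * m%:R) = 12 * (Q%:R * m%:R) * ln N%:R :> R by ring.
  by rewrite natrX expr2 ler_wpM2r ?(ltW lnN) // ler_wpM2l // ler_wpM2l // ler_nat.
have h3 : ln 2 * u <= ln 2 * (2 * (M%:R / ln M%:R)) by rewrite ler_wpM2l //; lra.
have : ln 2 / 3 * (M%:R / ln M%:R) = ln 2 * (2 * (M%:R / ln M%:R)) / 6 :> R by field; rewrite gt_eqF.
move: hpi h2 h3; lra.
Qed.

End SquarefreeCount.

(** * Asymptotics *)

Section Asymptotics.
Context {R : realType}.

(** As [ln] is 0 on nonpositive reals, [0 < a <= ln y] already forces [y > 0]. *)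
Lemma le_ln_expR (a y : R) : 0 < a -> a <= ln y -> expR a <= y.
Proof.
move=> a0 ay; have y0 : 0 < y.
  by rewrite ltNge; apply/negP => /ln0 E; move: ay; rewrite E leNgt a0.
by rewrite -[leRHS]lnK ?posrE // ler_expR.
Qed.

Lemma lnln_ge1 (x : R) : 1 <= ln (ln x) -> 2 <= ln x /\ 3 <= x.
Proof.
move=> h; have l2 : 2 <= ln x.
  by apply: le_trans (le_ln_expR _ _ ltr01 h); have := expR_ge1Dx (1 : R); lra.
split=> //; apply: le_trans (le_ln_expR _ _ (ltr0n _ 2) l2).
by have := expR_ge1Dx (2 : R); lra.
Qed.

Lemma truncn_facts (x : R) (N := Num.truncn x) : 3 <= x ->
  [/\ (1 < N)%N, N%:R <= x, x <= 2 * N%:R, N%:R / ln N%:R <= 2 * (x / ln x)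
    & x / ln x <= 2 * (N%:R / ln N%:R)].
Proof.
move=> x3; have x0 : 0 <= x by apply: le_trans x3.
have /andP[Nx xN] := truncn_itv x0; rewrite -/N in Nx xN.
have N1 : (1 < N)%N.
  rewrite -ltnS -(ltr_nat R); apply: le_lt_trans xN; apply: le_trans x3; exact: ler_nat.
have N1' : 1 < N%:R :> R by rewrite ltr1n.
have x2N : x <= 2 * N%:R by rewrite -natr1 in xN; lra.
have lN := @ln_nat_gt0 R N N1.
have lNx : ln N%:R <= ln x by rewrite ler_ln // posrE; lra.
have lxN : ln x <= 2 * ln N%:R.
  rewrite mulr2n mulrDl !mul1r -lnM ?posrE; try lra.
  rewrite ler_ln ?posrE ?mulr_gt0 ?ltr0n ?(ltnW N1) //; last by lra.
  by apply: (le_trans x2N); rewrite ler_wpM2r // ler_nat.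
have lx : 0 < ln x by apply: lt_le_trans lNx.
split=> //.
  rewrite ler_pdivrMr //.
  have -> : 2 * (x / ln x) * ln N%:R = x * (2 * ln N%:R / ln x) by ring.
  apply: (le_trans Nx); rewrite ler_peMr // ler_pdivlMr // mul1r //.
rewrite ler_pdivrMr //.
have -> : 2 * (N%:R / ln N%:R) * ln x = 2 * N%:R * (ln x / ln N%:R) by ring.
by apply: (le_trans x2N); rewrite ler_peMr ?mulr_ge0 // ler_pdivlMr // mul1r.
Qed.

Definition kappa (beta L : R) : R :=
  ln 2 `^ (beta / (1 + beta)) * L `^ (1 / (1 + beta)).

Lemma kappa_gt0 (beta L : R) : 0 < L -> 0 < kappa beta L.
Proof. by move=> L0; rewrite mulr_gt0 // powR_gt0 // ln2_gt0. Qed.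

(** Logarithmic form of [kappa ^ (1 + beta) = (ln 2) ^ beta * L], the shape in which [kappa] enters
    the estimates. *)
Lemma ln_kappa (beta L : R) : 0 < beta -> 0 < L ->
  (1 + beta) * ln (kappa beta L) = beta * ln (ln 2) + ln L.
Proof.
move=> b0 L0; rewrite lnM ?posrE ?powR_gt0 ?ln2_gt0 // !ln_powR.
by field; rewrite gt_eqF // addr_gt0.
Qed.

Lemma sum_G_le (beta : R) : 0 < beta -> exists2 C : R, 0 < C &
  forall x : R, 1 <= ln (ln x) ->
  \sum_(1 <= n < (Num.truncn x).+1) (G n)%:R `^ (- beta) <=
  C * (x / ln x) * expR ((1 + beta) * kappa beta (ln (ln x))).
Proof.
move=> b0; have [C C0 hC] := @sum_pow_omega_le R.
exists (2 `^ beta * (C * 2)); first by rewrite !mulr_gt0 // powR_gt0.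
move=> x x1; have [lx2 x3] := lnln_ge1 x x1.
have [N1 Nx _ Nln _] := truncn_facts x x3; set N := Num.truncn x in N1 Nx Nln *.
have b1 : 0 < 1 + beta by rewrite addr_gt0.
set L := ln (ln x) in x1 *; have L0 : 0 < L by lra.
have /andP[l12 l21] := @ln2_bounds R; have l0 := @ln2_gt0 R.
set k := kappa beta L; have k0 : 0 < k by exact: kappa_gt0.
have lnk := ln_kappa beta L b0 L0; rewrite -/k in lnk.
(* This [z] balances the two exponents: both [z * L] and [ln 2 / z ^ (1 / beta)] equal [kappa], so
   they add up to [(1 + beta) * kappa]. Both identities are checked on logarithms multiplied by
   [1 + beta]. *)
pose z := (ln 2 / L) `^ (beta / (1 + beta)).
have lL0 : 0 < ln 2 / L by rewrite divr_gt0.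
have z0 : 0 < z by rewrite powR_gt0.
have lnz : (1 + beta) * ln z = beta * (ln (ln 2) - ln L).
  by rewrite ln_powR ln_div ?posrE //; field; rewrite gt_eqF.
have z1 : z <= 1.
  rewrite -ler_ln ?posrE // ln1 ln_powR.
  apply: mulr_ge0_le0; first by rewrite divr_ge0 // ltW.
  by apply: ln_le0; rewrite ler_pdivrMr // mul1r; lra.
have zL : z * L = k.
  apply: ln_inj; [by rewrite posrE mulr_gt0 | by rewrite posrE |].
  rewrite lnM ?posrE //.
  by apply: (mulfI (lt0r_neq0 b1)); rewrite lnk mulrDr lnz; ring.
have zk : ln 2 / z `^ beta^-1 = k.
  apply: ln_inj; [by rewrite posrE divr_gt0 ?powR_gt0 | by rewrite posrE |].
  rewrite ln_div ?posrE ?powR_gt0 //.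
  apply: (mulfI (lt0r_neq0 b1)); rewrite lnk ln_powR mulrBr mulrCA lnz.
  by field; rewrite gt_eqF.
apply: le_trans (_ : \sum_(1 <= n < N.+1)
    2 `^ beta * expR (beta * k) * z ^+ size (primes n) <= _).
  by apply: ler_sum_nat => n /andP[n0 _]; rewrite -zk; exact: G_powR_le.
rewrite -mulr_sumr.
apply: le_trans (_ : 2 `^ beta * expR (beta * k) *
    (C * (N%:R / ln N%:R) * expR (z * ln (ln N%:R))) <= _).
  rewrite ler_wpM2l ?mulr_ge0 ?expR_ge0 ?powR_ge0 //; apply: hC => //.
  by rewrite (ltW z0) z1.
have lN := @ln_nat_gt0 R N N1.
have e1 : expR (z * ln (ln N%:R)) <= expR k.
  rewrite ler_expR -zL ler_wpM2l ?(ltW z0) // ler_ln ?posrE //; last lra.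
  by rewrite ler_ln ?posrE ?ltr0n ?(ltnW N1) //; lra.
rewrite mulrDl mul1r expRD.
have -> : 2 `^ beta * (C * 2) * (x / ln x) * (expR k * expR (beta * k)) =
  2 `^ beta * expR (beta * k) * (C * (2 * (x / ln x)) * expR k) by ring.
rewrite ler_wpM2l ?mulr_ge0 ?expR_ge0 ?powR_ge0 // ler_pM ?expR_ge0 //.
  by rewrite mulr_ge0 ?(ltW C0) // divr_ge0 // ltW.
by rewrite ler_wpM2l // ltW.
Qed.

(** Stirling in the form [n! <= e * n * (n / e) ^ n]; the induction step is
    [m * ln (1 - 1 / m) <= -1]. *)
Lemma ln_fact_le (n : nat) : (0 < n)%N ->
  ln n`!%:R <= 1 + n.+1%:R * ln n%:R - n%:R :> R.
Proof.
elim: n => // -[_ _|n IH _]; first by rewrite ln1 mulr0 addr0 subrr.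
have {IH} := IH isT; rewrite [n.+2`!]factS natrM lnM ?posrE ?ltr0n ?fact_gt0 //.
have a0 : 0 < n.+1%:R :> R by rewrite ltr0n.
have b0 : 0 < n.+2%:R :> R by rewrite ltr0n.
have := @ln_le_sub1 R (n.+1%:R / n.+2%:R); rewrite divr_gt0 // => /(_ isT).
rewrite ln_div ?posrE // => h.
have E : n.+2%:R * (n.+1%:R / n.+2%:R - 1) = - 1 :> R.
  by rewrite mulrBr mulrCA divff ?gt_eqF // !mulr1 -[n.+2%:R]natr1; ring.
have : n.+2%:R * (ln n.+1%:R - ln n.+2%:R) <= n.+2%:R * (n.+1%:R / n.+2%:R - 1) :> R.
  by rewrite ler_pM2l.
rewrite E -[n.+3%:R]natr1.
have -> : n.+1%:R = n.+2%:R - 1 :> R by rewrite -[n.+2%:R]natr1 addrK.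
lra.
Qed.

Lemma fact_ratio_ln (n : nat) :
  ln (fact_ratio n) = ln n`!%:R - n%:R * ln (ln 2) :> R.
Proof.
rewrite /fact_ratio ln_div ?posrE ?exprn_gt0 ?ln2_gt0 ?ltr0n ?fact_gt0 //.
by rewrite lnXn ?ln2_gt0 // mulr_natl.
Qed.

Lemma g_powR_ge (beta : R) (n j : nat) : 0 < beta -> (0 < n)%N ->
  (forall q, (logn q n <= 1)%N) -> size (primes n) = j ->
  fact_ratio j `^ (- beta) <= (g n)%:R `^ (- beta).
Proof.
move=> b0 n0 sqf nj; rewrite g_squarefree //.
have /andP[Gge Gle] := @G_bounds R n n0; rewrite nj in Gge Gle.
have f0 := @fact_ratio_gt0 R j.
have G0 : 0 < (G n)%:R :> R by apply: lt_le_trans Gge; rewrite divr_gt0.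
rewrite !powRN lef_pV2 ?posrE ?powR_gt0 //.
by apply: ge0_ler_powR; rewrite ?nnegrE // ltW.
Qed.

(* Stirling turns the logarithm of the right-hand side into
   [(1 + beta) * kappa] up to an error smaller than [delta * (1 + beta) * kappa]. *)
Lemma main_term_ge (beta delta : R) : 0 < beta -> 0 < delta ->
  exists eta K : R, [/\ 0 < eta, eta <= 2^-1 & forall (L : R) (j : nat), 0 < L ->
    K <= kappa beta L -> j.+1%:R <= kappa beta L <= j.+2%:R ->
    expR ((1 - delta) * (1 + beta) * kappa beta L) <=
    fact_ratio j.+1 `^ (- beta) * (ln 2 / 24) * (((1 - eta) * L) ^+ j / j`!%:R)].
Proof.
(* The bound [1 / 2] gives [ln (1 - eta) >= - 2 * eta]; the bound [delta / 6] keeps the resulting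
   loss [2 * eta * kappa] below [delta * kappa / 3]. *)
move=> b0 d0; pose eta := Num.min 2^-1 (delta / 6).
have eta0 : 0 < eta by rewrite lt_min invr_gt0 ltr0n divr_gt0.
have etah : eta <= 2^-1 by rewrite ge_min lexx.
have etad : eta <= delta / 6 by rewrite ge_min lexx orbT.
have [q qE] : exists q : R, q = ln 2 / 24 by exists (ln 2 / 24).
rewrite -qE; pose C := beta * ln (ln 2) + ln q.
(* Three losses each take at most a third of [delta * (1 + beta) * kappa]: the factor [1 - eta], the
   term [(1 + beta) * (2 * ln kappa + 2)] left by Stirling, and the constant [- C]. The two summands
   of this threshold control the last two. *)
exists eta, (`|12 * ln (delta / 12) / delta| + `|3 * C / delta|); split=> //.
move=> L j L0; set k := kappa beta L => kK /andP[jk kj].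
have l0 := @ln2_gt0 R; have /andP[_ l1] := @ln2_bounds R.
have k0 : 0 < k by exact: kappa_gt0.
have lnk := ln_kappa beta L b0 L0; rewrite -/k in lnk.
have m0 : 0 < 1 - eta by lra.
have f0 := @fact_ratio_gt0 R j.+1.
have j0 : 0 < j`!%:R :> R by rewrite ltr0n fact_gt0.
have j10 : 0 < j.+1`!%:R :> R by rewrite ltr0n fact_gt0.
have l240 : 0 < q by rewrite qE divr_gt0.
have mL0 : 0 < (1 - eta) * L by rewrite mulr_gt0.
rewrite -[leRHS]lnK ?posrE ?ler_expR; last first.
  by rewrite !mulr_gt0 ?powR_gt0 ?exprn_gt0 ?invr_gt0.
rewrite lnM ?posrE ?mulr_gt0 ?powR_gt0 ?exprn_gt0 ?invr_gt0 //.
rewrite lnM ?posrE ?powR_gt0 // ln_powR fact_ratio_ln ln_div ?posrE ?exprn_gt0 //.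
rewrite lnXn // lnM ?posrE // -[_ *+ j]mulr_natl.
have e1 : - (2 * eta) <= ln (1 - eta).
  have := @ln_le_sub1 R (1 - eta)^-1; rewrite invr_gt0 => /(_ m0).
  rewrite lnV ?posrE // => h; have : (1 - eta)^-1 <= 1 + 2 * eta.
    by rewrite -[leLHS]mul1r ler_pdivrMr //; nra.
  lra.
have e2 : ln (1 - eta) <= 0 by apply: ln_le0; lra.
have e3 : ln j`!%:R <= ln j.+1`!%:R :> R.
  by apply: ler_ln_nat; rewrite ?fact_gt0 // factS leq_pmull.
have jp : 0 < j.+1%:R :> R by rewrite ltr0n.
have e4 : ln j.+1%:R <= ln k by rewrite ler_ln ?posrE.
have e5 := @ln_fact_le j.+1 isT.
have e6 : ln j.+1`!%:R <= 1 + (j.+1%:R + 1) * ln k - j.+1%:R.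
  apply: (le_trans e5); rewrite lerD2r lerD2l natr1 ler_wpM2l //.
have dk0 : 0 < delta * k by rewrite mulr_gt0.
have e7 : ln k <= delta / 12 * k - 1 - ln (delta / 12).
  have d12 : 0 < delta / 12 by rewrite divr_gt0.
  have := @ln_le_sub1 R (delta / 12 * k); rewrite mulr_gt0 // lnM ?posrE // => /(_ isT).
  lra.
have e8 : - (12 * ln (delta / 12)) <= delta * k.
  rewrite [leRHS]mulrC -ler_pdivrMr // mulNr; apply: le_trans kK.
  by rewrite -[leLHS]addr0 lerD // -normrN ler_norm.
have e9 : - (3 * C) <= delta * k.
  rewrite [leRHS]mulrC -ler_pdivrMr // mulNr; apply: le_trans kK.
  by rewrite -[leLHS]add0r lerD // -normrN ler_norm.
have e10 : j.+1%:R * ln (1 - eta) >= - (2 * eta) * k.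
  apply: le_trans (_ : k * ln (1 - eta) <= _); first by rewrite mulrC ler_pM2l.
  by rewrite ler_wnM2r.
have e11 : eta * k <= delta * k / 6 by rewrite mulrAC ler_pM2r.
have e12 : (1 + beta) * ln j.+1`!%:R <=
    (1 + beta) * (1 + (j.+1%:R + 1) * ln k - j.+1%:R) by rewrite ler_wpM2l //; lra.
have e13 : (1 + beta) * (k - 1) <= (1 + beta) * j.+1%:R.
  by rewrite ler_wpM2l //; [lra | rewrite lerBlDr natr1].
have e14 : (1 + beta) * ln k <= (1 + beta) * (delta / 12 * k - 1 - ln (delta / 12)).
  by rewrite ler_wpM2l //; lra.
have e15 : (1 + beta) * - (12 * ln (delta / 12)) <= (1 + beta) * (delta * k).
  by rewrite ler_wpM2l //; lra.
have e16 : delta * k <= (1 + beta) * (delta * k) by rewrite ler_peMl ?(ltW dk0) //; lra.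
have e17 : j.+1%:R * ((1 + beta) * ln k) = j.+1%:R * (beta * ln (ln 2) + ln L) by rewrite lnk.
have -> : j%:R = j.+1%:R - 1 :> R by rewrite -natr1 addrK.
rewrite /C in e9.
lra.
Qed.

Lemma sum_g_ge (beta delta : R) : 0 < beta -> 0 < delta -> exists K : R,
  forall x : R, 1 <= ln (ln x) -> K <= kappa beta (ln (ln x)) ->
  x / ln x * expR ((1 - delta) * (1 + beta) * kappa beta (ln (ln x))) <=
  \sum_(1 <= n < (Num.truncn x).+1) (g n)%:R `^ (- beta).
Proof.
move=> b0 d0; have [eta [K0 [eta0 etah main]]] := main_term_ge beta delta b0 d0.
(* In order, the summands provide the threshold of [main_term_ge], a positive integer part of
   [kappa], the inequality [6 * kappa <= eta * L], and a numerical bound making [x] large. *)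
exists (`|K0| + 2 + (6 / eta) `^ beta^-1 + 192 / ln 2) => x x1.
have [lx2 x3] := lnln_ge1 x x1.
have [N1 Nx xN _ Nln] := truncn_facts x x3; set N := Num.truncn x in N1 Nx xN Nln *.
set L := ln (ln x) in x1 *; set k := kappa beta L => kK.
have L0 : 0 < L by lra.
have l0 := @ln2_gt0 R; have /andP[_ l1] := @ln2_bounds R.
have k0 : 0 < k by exact: kappa_gt0.
have p0 : 0 < (6 / eta) `^ beta^-1 by rewrite powR_gt0 // divr_gt0.
have q0 : 0 < 192 / ln 2 :> R by rewrite divr_gt0.
have kK0 : K0 <= k by have := ler_norm K0; lra.
have n0 : 0 <= `|K0| by [].
have k2 : 2 <= k by lra.
have kq : 192 / ln 2 <= k by lra.
have kp : (6 / eta) `^ beta^-1 <= k by lra.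
have lnk := ln_kappa beta L b0 L0; rewrite -/k in lnk.
(* Here [kappa * kappa ^ beta = (ln 2) ^ beta * L <= L], and [kappa ^ beta >= 6 / eta]. *)
have kL : 6 * k <= eta * L.
  rewrite -ler_pdivrMl // (_ : eta^-1 * (6 * k) = 6 / eta * k); last by ring.
  have r0 : 0 < 6 / eta by rewrite divr_gt0.
  rewrite -ler_ln ?posrE ?(mulr_gt0 r0 k0) //.
  have : ln ((6 / eta) `^ beta^-1) <= ln k by rewrite ler_ln ?posrE.
  rewrite ln_powR mulrC ler_pdivrMr // => h.
  have := @ln_le0 R (ln 2) l1 => h2.
  have : beta * ln (ln 2) <= 0 by rewrite mulr_ge0_le0 // ltW.
  rewrite lnM ?posrE ?divr_gt0 //; lra.
clear lnk kp p0 n0 q0 kK.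
have [j [jk kj]] : exists j : nat, j.+1%:R <= k /\ k <= j.+2%:R.
  have := truncn_itv (ltW k0); set t := Num.truncn k => /andP[tk kt].
  case: t tk kt => [|j] tk kt; first by lra.
  by exists j; rewrite (ltW kt).
have u0 : 0 < ln x by lra.
set u := ln x in lx2 u0 *; have uL : ln u = L by [].
have m0 : 0 < 4 * j.+1%:R :> R by rewrite mulr_gt0 // ltr0n.
(* This is [x ^ (1 / (4 * (j + 1)))], so that [(w ^ j) ^ 2] is at most the square root of [x]. *)
pose y := expR (u / (4 * j.+1%:R)).
have y1 : 1 <= y by rewrite -expR0 ler_expR divr_ge0 // ltW.
have y0 : 0 <= y by exact: expR_ge0.
have /andP[wy yw] := truncn_itv y0; set w := Num.truncn y in wy yw.
have w0 : (0 < w)%N by rewrite -ltnS -(ltr_nat R); exact: le_lt_trans yw.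
(* Mertens gives [L - ln (4 * (j + 1)) - 1]; bounding this logarithm by [4 * (j + 1) - 1] costs at
   most [4 * kappa], and subtracting [j] at most one more [kappa]. *)
have S1 : L - 5 * k <= prime_sum w - j%:R.
  have := @prime_sum_ge R w w0.
  have e1 : u / (4 * j.+1%:R) <= ln w.+1%:R.
    by rewrite -ler_expR lnK ?posrE ?ltr0n // ltW.
  have e0 : 0 < u / (4 * j.+1%:R) by rewrite divr_gt0.
  have : ln (u / (4 * j.+1%:R)) <= ln (ln w.+1%:R).
    by rewrite ler_ln ?posrE //; apply: lt_le_trans e1.
  rewrite ln_div ?posrE // uL; have h1 := @ln_le_sub1 R _ m0; move=> h2 h3.
  have jE : j.+1%:R = j%:R + 1 :> R by rewrite natr1.
  rewrite jE in jk h1 h2 *; move: jk h1 h2 h3; clearbody k L u w y.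
  move: (ln _) (ln (ln _)) (prime_sum w) => a b s; clear; lra.
have S2 : (1 - eta) * L <= prime_sum w - j%:R by lra.
have mL0 : 0 < (1 - eta) * L by rewrite mulr_gt0 //; lra.
have QN : 12 * ((w ^ j) ^ 2)%:R * ln N%:R <= ln 2 * N%:R :> R.
  have e1 : ((w ^ j) ^ 2)%:R <= expR (u / 2).
    rewrite !natrX; apply: le_trans (_ : (y ^+ j) ^+ 2 <= _).
      by rewrite !lerXn2r ?nnegrE ?exprn_ge0.
    rewrite -exprM /y -expRM_natl ler_expR natrM.
    have -> : j%:R * 2%:R * (u / (4 * j.+1%:R)) = u / 2 * (j%:R / j.+1%:R) :> R.
      have : j.+1%:R != 0 :> R by rewrite pnatr_eq0.
      by move: (j.+1%:R) => v v0; field.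
    rewrite ler_piMr ?divr_ge0 ?(ltW u0) // ler_pdivrMr ?ltr0n // mul1r ler_nat //.
  have e2 : ln N%:R <= u.
    by rewrite ler_ln ?posrE ?ltr0n ?(ltnW N1) //; lra.
  have xE : x = expR (u / 2) * expR (u / 2).
    by rewrite -expRD -splitr lnK // posrE; lra.
  (* The 24 is 12 doubled because [N >= x / 2]. From [exp (u / 2) >= u ^ 2 / 8] it suffices that
     [u * ln 2 >= 192 = 24 * 8]. *)
  have e3 : 24 * u <= ln 2 * expR (u / 2).
    have uk : k <= u.
      have -> : u = expR L by rewrite lnK ?posrE.
      have := expR_ge1Dx L; nra.
    have := @expR_ge1Dxn R (u / 2) 1; rewrite divr_ge0 ?(ltW u0) // => /(_ isT) h.
    have h2 : u ^+ 2 / 8 <= expR (u / 2).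
      apply: le_trans h; rewrite expr_div_n (_ : 2`!%:R = 2) //; lra.
    apply: le_trans (_ : ln 2 * (u ^+ 2 / 8) <= _); last by rewrite ler_pM2l.
    have : 192 <= u * ln 2 by rewrite -ler_pdivrMr //; lra.
    nra.
  have lN := @ln_nat_gt0 R N N1.
  apply: le_trans (_ : 12 * expR (u / 2) * u <= _).
    by rewrite ler_pM ?(ltW lN) ?mulr_ge0 // ler_pM2l.
  apply: le_trans (_ : ln 2 * (x / 2) <= _); last by rewrite ler_pM2l // ler_pdivrMr // mulrC.
  rewrite xE; have := ler_wpM2r (expR_ge0 (u / 2)) e3.
  have -> : 12 * expR (u / 2) * u = 2^-1 * (24 * u * expR (u / 2)) by field.
  have -> : ln 2 * (expR (u / 2) * expR (u / 2) / 2) =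
    2^-1 * (ln 2 * expR (u / 2) * expR (u / 2)) by field.
  by rewrite ler_pM2l ?invr_gt0.
have jS : j%:R <= prime_sum w :> R.
  by rewrite -subr_ge0; apply: le_trans S2; exact: ltW.
have x0 : 0 <= x by exact: le_trans x3.
have := @squarefree_count_ge R (fun n => (g n)%:R `^ (- beta))
  (fact_ratio j.+1 `^ (- beta)) w j N
  (powR_ge0 _ _) (fun=> powR_ge0 _ _)
  (fun n n0 sqf nj => g_powR_ge beta n j.+1 b0 n0 sqf nj) w0 N1 jS QN.
apply: le_trans.
have j0 : 0 < j`!%:R :> R by rewrite ltr0n fact_gt0.
apply: le_trans (_ : x / u * (fact_ratio j.+1 `^ (- beta) * (ln 2 / 24) *
    (((1 - eta) * L) ^+ j / j`!%:R)) <= _).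
  rewrite ler_wpM2l ?divr_ge0 ?(ltW u0) //.
  by apply: main => //; rewrite jk kj.
have -> : x / u * (fact_ratio j.+1 `^ (- beta) * (ln 2 / 24) *
    (((1 - eta) * L) ^+ j / j`!%:R)) = fact_ratio j.+1 `^ (- beta) *
    (ln 2 / 12 * (x / u / 2) * (((1 - eta) * L) ^+ j / j`!%:R)) by field; rewrite !gt_eqF.
rewrite ler_wpM2l ?powR_ge0 //; apply: ler_pM.
- by rewrite !mulr_ge0 ?invr_ge0 ?(ltW u0) ?(ltW l0).
- by rewrite divr_ge0 ?exprn_ge0 // ltW.
- by rewrite ler_pM2l ?divr_gt0 // ler_pdivrMr // [leRHS]mulrC.
- by rewrite ler_pM2r ?invr_gt0 // lerXn2r ?nnegrE // ltW //; apply: lt_le_trans S2.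
Qed.

End Asymptotics.

(** * From two-sided bounds to the [o(1)] form *)

Section Epsilon.
Context {R : realType}.
Local Open Scope classical_set_scope.

Lemma near_lnln_ge (a : R) : \forall x \near +oo, a <= ln (ln x).
Proof.
near=> x; have xa : expR (expR a) <= x by near: x; exact: nbhs_pinfty_ge.
rewrite -ler_expR lnK; last first.
  rewrite posrE; apply: lt_le_trans (expR_gt0 a) _.
  by rewrite -[leLHS]expRK ler_ln ?posrE ?expR_gt0 //; exact: lt_le_trans xa.
by rewrite -[leLHS]expRK ler_ln ?posrE ?expR_gt0 //; exact: lt_le_trans xa.
Unshelve. all: by end_near. Qed.

Lemma near_kappa_ge (beta a : R) : 0 < beta ->
  \forall x \near +oo, a <= kappa beta (ln (ln x)).
Proof.
move=> b0; have a0 : 0 < `|a| + 1 by rewrite ltr_wpDl.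
near=> x.
have L1 : 1 <= ln (ln x) by near: x; exact: near_lnln_ge.
(* The threshold is [ln_kappa] solved for [L] at [kappa = |a| + 1]. *)
have L2 : expR ((1 + beta) * ln (`|a| + 1) - beta * ln (ln 2)) <= ln (ln x).
  by near: x; exact: near_lnln_ge.
have L0 : 0 < ln (ln x) by lra.
apply: le_trans (_ : `|a| + 1 <= _); first by have := ler_norm a; lra.
rewrite -ler_ln ?posrE ?kappa_gt0 //.
have b1 : 0 < 1 + beta by rewrite addr_gt0.
rewrite -(ler_pM2l b1) ln_kappa // -lerBlDl -ler_expR [leRHS]lnK //.
Unshelve. all: by end_near. Qed.

(** The required equality is solved for [eps x], and the hypothesis at [delta] says exactly that
    [|eps x| <= delta] eventually. *)
Lemma exists_epsilon (beta : R) (S : R -> R) : 0 < beta ->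
  (forall delta, 0 < delta -> \forall x \near +oo,
     x / ln x * expR ((1 - delta) * (1 + beta) * kappa beta (ln (ln x))) <= S x <=
     x / ln x * expR ((1 + delta) * (1 + beta) * kappa beta (ln (ln x)))) ->
  exists2 eps : R -> R, eps x @[x --> +oo] --> 0 &
    \forall x \near +oo, S x =
      x / ln x *
        expR ((1 + eps x) * (1 + beta) * ln 2 `^ (beta / (1 + beta)) *
              ln (ln x) `^ (1 / (1 + beta))).
Proof.
move=> b0 HS.
pose M x := (1 + beta) * kappa beta (ln (ln x)).
have b1 : 0 < 1 + beta by rewrite addr_gt0.
have pos x : 1 <= ln (ln x) -> 0 < x / ln x /\ 0 < M x.
  move=> L1; have [l2 x3] := lnln_ge1 x L1; split.
    by rewrite divr_gt0 //; lra.
  by rewrite mulr_gt0 // kappa_gt0 //; lra.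
exists (fun x => ln (S x / (x / ln x)) / M x - 1).
  apply/cvgr0Pnorm_le => e e0; near=> x.
  have L1 : 1 <= ln (ln x) by near: x; exact: near_lnln_ge.
  have [X0 M0] := pos x L1.
  have /andP[S1 S2] : x / ln x * expR ((1 - e) * (1 + beta) * kappa beta (ln (ln x))) <= S x <=
     x / ln x * expR ((1 + e) * (1 + beta) * kappa beta (ln (ln x))).
    by near: x; exact: HS.
  move: S1 S2; rewrite -!(mulrA _ (1 + beta)) -/(M x) => S1 S2.
  have S0 : 0 < S x by apply: lt_le_trans S1; rewrite mulr_gt0 // expR_gt0.
  have T0 : 0 < S x / (x / ln x) by rewrite divr_gt0.
  rewrite mulrC -ler_pdivlMr // mulrC in S1.
  rewrite mulrC -ler_pdivrMr // in S2.
  rewrite -[S x / _]lnK ?posrE // !ler_expR in S1 S2.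
  rewrite ler_norml; apply/andP; split.
    by rewrite lerBrDr addrC ler_pdivlMr // mulrC.
  by rewrite lerBlDr addrC ler_pdivrMr.
near=> x.
have L1 : 1 <= ln (ln x) by near: x; exact: near_lnln_ge.
have [X0 M0] := pos x L1.
have S0 : 0 < S x.
  (* The value [delta = 1] serves only to make [S x] positive, so that its logarithm can be
     inverted. *)
  have /andP[S1 _] : x / ln x * expR ((1 - 1) * (1 + beta) * kappa beta (ln (ln x))) <= S x <=
     x / ln x * expR ((1 + 1) * (1 + beta) * kappa beta (ln (ln x))).
    by near: x; exact: HS.
  by apply: lt_le_trans S1; rewrite mulr_gt0 // expR_gt0.
have T0 : 0 < S x / (x / ln x) by rewrite divr_gt0.
rewrite -[_ * _ * _ * _]mulrA -/(kappa beta (ln (ln x))) -[_ * _ * kappa _ _]mulrA -/(M x).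
rewrite addrC subrK divfK ?gt_eqF // lnK ?posrE // mulrC divfK // gt_eqF //.
Unshelve. all: by end_near. Qed.

End Epsilon.

Local Open Scope classical_set_scope.
Local Open Scope ring_scope.

Theorem theorem1p10 (R : realType) (beta : R) (beta_gt0 : 0 < beta) :
  (exists2 eps : R -> R, eps x @[x --> +oo] --> 0 &
    \forall x \near +oo_R,
      \sum_(1 <= n < (Num.truncn x).+1) (g n)%:R `^ (- beta) =
      x / ln x *
        expR ((1 + eps x) * (1 + beta) * ln 2 `^ (beta / (1 + beta)) *
              ln (ln x) `^ (1 / (1 + beta))))
  /\
  (exists2 eps : R -> R, eps x @[x --> +oo] --> 0 &
    \forall x \near +oo_R,
      \sum_(1 <= n < (Num.truncn x).+1) (G n)%:R `^ (- beta) =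
      x / ln x *
        expR ((1 + eps x) * (1 + beta) * ln 2 `^ (beta / (1 + beta)) *
              ln (ln x) `^ (1 / (1 + beta)))).
Proof.
pose Sg (x : R) : R := \sum_(1 <= n < (Num.truncn x).+1) (g n)%:R `^ (- beta).
pose SG (x : R) : R := \sum_(1 <= n < (Num.truncn x).+1) (G n)%:R `^ (- beta).
have gG x : Sg x <= SG x.
  apply: ler_sum_nat => n /andP[n0 _].
  have /andP[Gn _] := @G_bounds R n n0.
  have G0 : 0 < (G n)%:R :> R by apply: lt_le_trans Gn; rewrite divr_gt0 ?fact_ratio_gt0.
  have Gg : (G n)%:R <= (g n)%:R :> R by rewrite ler_nat G_le_g.
  have g0 := lt_le_trans G0 Gg.
  rewrite !powRN lef_pV2 ?posrE ?powR_gt0 //.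
  by apply: ge0_ler_powR; rewrite ?nnegrE // ltW.
have [C C0 upper] := sum_G_le beta beta_gt0.
(* Because [Sg <= SG], a lower bound for [Sg] and an upper bound for [SG] enclose both sums. *)
have key (delta : R) : 0 < delta -> \forall x \near +oo,
    [/\ x / ln x * expR ((1 - delta) * (1 + beta) * kappa beta (ln (ln x))) <= Sg x &
    SG x <= x / ln x * expR ((1 + delta) * (1 + beta) * kappa beta (ln (ln x)))].
  move=> d0; have [K lower] := sum_g_ge beta delta beta_gt0 d0; near=> x.
  have L1 : 1 <= ln (ln x) by near: x; exact: near_lnln_ge.
  split; first by apply: lower => //; near: x; exact: near_kappa_ge.
  have [l2 x3] := lnln_ge1 x L1.
  apply: (le_trans (upper x L1)).
  (* The constant is absorbed in the exponent, since [ln C <= delta * (1 + beta) * kappa] once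
     [kappa] is large. *)
  have -> : C * (x / ln x) = x / ln x * expR (ln C) by rewrite lnK ?posrE // mulrC.
  have xl : 0 <= x / ln x by rewrite divr_ge0 //; lra.
  rewrite -mulrA -expRD ler_wpM2l // ler_expR.
  have : ln C / (delta * (1 + beta)) <= kappa beta (ln (ln x)).
    by near: x; exact: near_kappa_ge.
  by rewrite ler_pdivrMr ?mulr_gt0 ?addr_gt0 //; lra.
split; apply: exists_epsilon => // delta d0; apply: filterS (key delta d0) => x [h1 h2].
- by rewrite h1 (le_trans (gG x)).
- by rewrite h2 andbT (le_trans h1).
Unshelve. all: by end_near. Qed.
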